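(* Let $(\mathcal G,\lambda,\mu)$ be a measure semigroupoid. If $(\mathcal G,\lambda,\mu)$ is Liouville, then it is Reiter.
   Context: A semigroupoid is a small category: a set $\mathcal G$ of morphisms, a set $\mathcal G^{(0)}$ of objects (units), surjective source and target maps $\mathbf s,\mathbf t:\mathcal G\to\mathcal G^{(0)}$, and a composition $(\zeta,\eta)\mapsto\zeta\eta$ defined on $\mathcal G^{(2)}=\{(\zeta,\eta)\in\mathcal G^2:\mathbf s(\zeta)=\mathbf t(\eta)\}$. Units are identified with identity morphisms, so $\mathcal G^{(0)}\subseteq\mathcal G$. For $x\in\mathcal G^{(0)}$ put $\mathcal G^x=\mathbf t^{-1}(x)$. An analytic Borel space is a measurable space isomorphic to an analytic subset (continuous image of a Polish space) of a Polish space with the relative Borel structure. A Borel semigroupoid is a semigroupoid $\mathcal G$ such that $\mathcal G$ is an analytic Borel space, $\mathcal G^{(0)}$ is an analytic Borel space as a subspace of $\mathcal G$, and $\mathbf s$, $\mathbf t$ and the composition are Borel. A Borel system of measures on $\mathcal G$ is a family $\lambda=(\lambda^x)_{x\in\mathcal G^{(0)}}$ of $\sigma$-finite positive Borel measures $\lambda^x$ on $\mathcal G^x$ (regarded also as measures on $\mathcal G$ vanishing outside $\mathcal G^x$) such that $x\mapsto\int_{\mathcal G}f\,d\lambda^x\in[0,\infty]$ is Borel for every non-negative Borel function $f$ on $\mathcal G$. For $\gamma\in\mathcal G$ and a measure $\rho$ on $\mathcal G^{\mathbf s(\gamma)}$, $\gamma\rho$ denotes the pushforward of $\rho$ under $\mathcal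 G^{\mathbf s(\gamma)}\to\mathcal G^{\mathbf t(\gamma)}$, $\eta\mapsto\gamma\eta$. Write $\nu_1\prec\nu_2$ for absolute continuity of $\nu_1$ with respect to $\nu_2$. A quasi-Haar system on $\mathcal G$ is a Borel system of measures $\lambda$ such that $\gamma\lambda^{\mathbf s(\gamma)}\prec\lambda^{\mathbf t(\gamma)}$ for all $\gamma\in\mathcal G$ and $(\gamma,\eta)\in\mathcal G^2\mapsto\frac{d(\gamma\lambda^{\mathbf s(\gamma)})}{d\lambda^{\mathbf t(\gamma)}}(\eta)\in[0,\infty]$ is Borel. A Borel system $\lambda$ is proper if there is an increasing sequence of Borel sets $A_n$ with $\mathcal G=\bigcup_nA_n$ such that for each $n$ the map $x\mapsto\lambda^x(A_n)\in\mathbb R$ is bounded. A measure semigroupoid is a triple $(\mathcal G,\lambda,\mu)$ with $\mathcal G$ a Borel semigroupoid, $\lambda$ a proper quasi-Haar system on $\mathcal G$ and $\mu$ a positive Borel measure on $\mathcal G^{(0)}$. A Borel system $\theta=(\theta^x)_{x\in\mathcal G^{(0)}}$ of probability measures $\theta^x$ on $\mathcal G^x$ is $\lambda$-adapted if $\theta^x\prec\lambda^x$ for every $x$ and $(\gamma,\eta)\in\mathcal G^2\mapsto\frac{d(\gamma\theta^{\mathbf s(\gamma)})}{d\lambda^{\mathbf t(\gamma)}}(\eta)\in[0,\infty]$ is Borel. The measure $\mu\star\lambda$ on $\mathcal G$ is $(\mu\star\lambda)(E)=\int_{\mathcal G^{(0)}}\lambda^x(E)\,d\mu(x)$. $\|\cdot\|$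 is the total variation norm. $(\mathcal G,\lambda,\mu)$ is Reiter if there is a sequence $(\theta_n)_n$ of $\lambda$-adapted Borel systems of probability measures $\theta_n=(\theta_n^x)_x$ such that $\lim_{n\to\infty}\int_{\mathcal G}\|\theta_n^{\mathbf t(\gamma)}-\gamma\theta_n^{\mathbf s(\gamma)}\|f(\gamma)\,d(\mu\star\lambda)(\gamma)=0$ for all $f\in L^1(\mathcal G,\mu\star\lambda)$. For a $\lambda$-adapted Borel system of probability measures $\pi=(\pi_x)_x$, define $P_x:L^\infty(\mathcal G^x,\lambda^x)\to L^\infty(\mathcal G^x,\lambda^x)$ by $P_x(f)(\zeta)=\int_{\mathcal G^{\mathbf s(\zeta)}}f(\zeta\eta)\,d\pi_{\mathbf s(\zeta)}(\eta)$, and $H_{\pi,x}(\mathcal G)=\{f\in L^\infty(\mathcal G^x,\lambda^x):P_x(f)=f\}$. $(\mathcal G,\lambda,\mu)$ is Liouville if there is a $\lambda$-adapted Borel system of probability measures $\pi$ with $H_{\pi,x}(\mathcal G)=\mathbb C\mathbf 1$ (the constants) for $\mu$-a.e. $x\in\mathcal G^{(0)}$. *)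

(* Defs.v *)
From HB Require Import structures.
From mathcomp Require Import all_boot all_order all_algebra.
From mathcomp Require Import all_classical all_reals all_analysis.
From mathcomp Require Import measurable_realfun ess_sup_inf.
From mathcomp Require Import complex.
Import Order.TTheory GRing.Theory Num.Theory.
Import numFieldNormedType.Exports.

Set Implicit Arguments.
Unset Strict Implicit.
Unset Printing Implicit Defensive.

Local Open Scope classical_set_scope.
Local Open Scope ring_scope.

(* A Hausdorff pseudometric is a metric.  Polish spaces are existentially
   quantified below, so fixing a complete metric on them loses nothing. *)
Definition polish (R : realType) (X : completePseudoMetricType R) : Prop :=
  hausdorff_space X /\ exists2 D : set X, countable D & dense D.

(* The empty set is added by hand because complete spaces are pointed. *)
Definition analytic_set (R : realType) (X : completePseudoMetricType R)
    (A : set X) : Prop :=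
  A = set0 \/
  exists (Y : completePseudoMetricType R) (f : Y -> X),
    [/\ polish Y, continuous f & range f = A].

Definition analytic_borel (R : realType) (d : measure_display)
    (T : measurableType d) : Prop :=
  exists (X : completePseudoMetricType R) (A : set X) (phi : T -> X),
    [/\ polish X, analytic_set A, injective phi, range phi = A
      & @measurable d T =
          preimage_set_system setT phi <<s [set U : set X | open U] >>].

(* [G] is the set of morphisms, [G0] the set of objects, and [unit_of] the
   inclusion of the units.  [gcomp z e] is the composition z e when
   [src z = tgt e]; its values at other pairs are junk and are never used. *)
Record semigroupoid (G G0 : Type) := Semigroupoid {
  src : G -> G0 ;
  tgt : G -> G0 ;
  unit_of : G0 -> G ;
  gcomp : G -> G -> G ;
  src_unit : forall x, src (unit_of x) = x ;
  tgt_unit : forall x, tgt (unit_of x) = x ;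
  src_gcomp : forall z e, src z = tgt e -> src (gcomp z e) = src e ;
  tgt_gcomp : forall z e, src z = tgt e -> tgt (gcomp z e) = tgt z ;
  gcomp_unit_l : forall z, gcomp (unit_of (tgt z)) z = z ;
  gcomp_unit_r : forall z, gcomp z (unit_of (src z)) = z ;
  gcomp_assoc : forall z e w, src z = tgt e -> src e = tgt w ->
    gcomp z (gcomp e w) = gcomp (gcomp z e) w
}.

Definition composable (G G0 : Type) (S : semigroupoid G G0) : set (G * G) :=
  [set p | src S p.1 = tgt S p.2].

(* [G0] carries the Borel structure of a subspace of [G].  The set of
   composable pairs is measurable, since points of an analytic Borel space are
   separated by countably many measurable sets; hence [measurable_fun] on it is
   measurability for the relative Borel structure. *)
Record borel_semigroupoid (R : realType) (d d0 : measure_display)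
    (G : measurableType d) (G0 : measurableType d0) := BorelSemigroupoid {
  bs_semigroupoid :> semigroupoid G G0 ;
  bs_analytic : analytic_borel R G ;
  bs_analytic_units : analytic_borel R G0 ;
  bs_subspace : @measurable d0 G0 =
    preimage_set_system setT (unit_of bs_semigroupoid) (@measurable d G) ;
  bs_measurable_src : measurable_fun setT (src bs_semigroupoid) ;
  bs_measurable_tgt : measurable_fun setT (tgt bs_semigroupoid) ;
  bs_measurable_comp : measurable_fun (composable bs_semigroupoid)
    (fun p : G * G => gcomp bs_semigroupoid p.1 p.2)
}.

Section systems_of_measures.
Local Open Scope ereal_scope.
Context {R : realType} {d d0 : measure_display}
  {G : measurableType d} {G0 : measurableType d0}.
Variable S : semigroupoid G G0.

Definition fiber (x : G0) : set G := tgt S @^-1` [set x].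

Definition borel_system (rho : G0 -> {measure set G -> \bar R}) : Prop :=
  [/\ forall x, sigma_finite setT (rho x),
      forall x, rho x (~` fiber x) = 0
    & forall f : G -> \bar R, measurable_fun setT f -> (forall y, 0 <= f y) ->
        measurable_fun setT (fun x : G0 => \int[rho x]_y f y)].

(* pushforward of [rho], restricted to the fiber over [src g], under
   left multiplication by [g] *)
Definition translate (g : G) (rho : set G -> \bar R) : set G -> \bar R :=
  fun A => rho (fiber (src S g) `&` gcomp S g @^-1` A).

(* The Radon-Nikodym derivative of [g nu^(src g)] with respect to
   [lam^(tgt g)] is only defined up to null sets: its being Borel in both
   variables means that it has a version that is. *)
Definition borel_translate_density (nu lam : G0 -> {measure set G -> \bar R})
    : Prop :=
  exists D : G * G -> \bar R,
    [/\ measurable_fun setT D, forall p, 0 <= D p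
      & forall (g : G) (A : set G), measurable A ->
          translate g (nu (src S g)) A
            = \int[lam (tgt S g)]_(e in A) D (g, e)].

Definition quasi_haar (lam : G0 -> {measure set G -> \bar R}) : Prop :=
  [/\ borel_system lam,
      forall g, translate g (lam (src S g)) `<< lam (tgt S g)
    & borel_translate_density lam lam].

Definition proper_system (lam : G0 -> {measure set G -> \bar R}) : Prop :=
  exists A : nat -> set G,
    [/\ forall n, measurable (A n),
        forall n m, (n <= m)%N -> A n `<=` A m,
        \bigcup_n A n = setT
      & forall n, exists M : R, forall x, lam x (A n) <= M%:E].

Definition adapted (lam : G0 -> {measure set G -> \bar R})
    (theta : G0 -> probability G R) : Prop :=
  [/\ borel_system theta,
      forall x, theta x `<< lam x
    & borel_translate_density theta lam].

Definition star (mu : {measure set G0 -> \bar R})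
    (lam : G0 -> {measure set G -> \bar R}) : set G -> \bar R :=
  fun E => \int[mu]_x lam x E.

End systems_of_measures.

Record measure_semigroupoid (R : realType) (d d0 : measure_display)
    (G : measurableType d) (G0 : measurableType d0) := MeasureSemigroupoid {
  ms_semigroupoid :> borel_semigroupoid R G G0 ;
  ms_lambda : G0 -> {measure set G -> \bar R} ;
  ms_mu : {measure set G0 -> \bar R} ;
  ms_quasi_haar : quasi_haar ms_semigroupoid ms_lambda ;
  ms_proper : proper_system ms_lambda
}.

Definition total_variation {R : realType} {d : measure_display}
    {T : measurableType d} (nu : set T -> \bar R) : \bar R :=
  ereal_sup [set r | exists (n : nat) (A : 'I_n -> set T),
    [/\ forall i, measurable (A i), trivIset setT A, \bigcup_i A i = setT
      & r = (\sum_(i < n) `|nu (A i)|)%E]].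

Section complex_valued.
Context {R : realType} {d : measure_display} {T : measurableType d}.
Implicit Types (mu : set T -> \bar R) (f : T -> R[i]).

Definition cmeasurable f : Prop :=
  measurable_fun setT (fun y => complex.Re (f y)) /\
  measurable_fun setT (fun y => complex.Im (f y)).

Definition cintegrable mu f : Prop :=
  mu.-integrable setT (fun y => (complex.Re (f y))%:E) /\
  mu.-integrable setT (fun y => (complex.Im (f y))%:E).

Definition cintegral mu (D : set T) f : R[i] :=
  Complex (fine (\int[mu]_(y in D) (complex.Re (f y))%:E)%E)
          (fine (\int[mu]_(y in D) (complex.Im (f y))%:E)%E).

Definition cLinfty (mu : {measure set T -> \bar R}) f : Prop :=
  cmeasurable f /\ (ess_sup mu (fun y => (Normc.normc (f y))%:E) < +oo)%E.

End complex_valued.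

Section reiter_liouville.
Context {R : realType} {d d0 : measure_display}
  {G : measurableType d} {G0 : measurableType d0}.
Variable M : measure_semigroupoid R G G0.

(* The total variation norm is at most 2, so [fine] is harmless. *)
Definition defect (theta : G0 -> probability G R) (g : G) : R :=
  fine (total_variation (fun A =>
    theta (tgt M g) A - translate M g (theta (src M g)) A)%E).

Definition reiter : Prop :=
  exists theta : nat -> G0 -> probability G R,
    (forall n, adapted M (ms_lambda M) (theta n)) /\
    forall f : G -> R[i], cintegrable (star (ms_mu M) (ms_lambda M)) f ->
      (fun n => cintegral (star (ms_mu M) (ms_lambda M)) setT
                  (fun g => real_complex R (defect (theta n) g) * f g))
        @ \oo --> (0 : R[i]^o).

Definition markov_op (pi : G0 -> probability G R) (f : G -> R[i]) (z : G)
    : R[i] :=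
  cintegral (pi (src M z)) (fiber M (src M z)) (fun e => f (gcomp M z e)).

(* Classes in L^oo(G^x, lambda^x) are represented by functions on [G], as
   lambda^x vanishes outside G^x. *)
Definition harmonic_functions (pi : G0 -> probability G R) (x : G0)
    : set (G -> R[i]) :=
  [set f | cLinfty (ms_lambda M x) f /\
           \forall z \ae ms_lambda M x, markov_op pi f z = f z].

Definition ae_constant (x : G0) : set (G -> R[i]) :=
  [set f | cLinfty (ms_lambda M x) f /\
           exists c : R[i], \forall z \ae ms_lambda M x, f z = c].

Definition liouville : Prop :=
  exists pi : G0 -> probability G R,
    adapted M (ms_lambda M) pi /\
    \forall x \ae ms_mu M, harmonic_functions pi x = ae_constant x.

End reiter_liouville.

(* Main.v *)
Require Import Defs.
From HB Require Import structures.
From mathcomp Require Import all_boot all_order all_algebra.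
From mathcomp Require Import all_classical all_reals all_analysis.
From mathcomp Require Import measurable_realfun ess_sup_inf complex.
From mathcomp Require Import ring lra.
Import Order.TTheory GRing.Theory Num.Theory.
Import numFieldNormedType.Exports.

(** Let [law] be a system of probabilities with the Liouville property, and let
    [K z] be the translate of [law (src z)] by [z].  Then [K] is a Markov kernel
    on the morphisms that preserves the fibers of the target map and commutes
    with left translations.  Take for [theta n x] the average of the laws of
    the first [n.+1] steps of the chain started at the unit over [x].  By
    commutation, the translate of [theta n (src g)] by [g] is the same average
    for the chain started at [g].  So Reiter's condition says that the averages
    started at two points of one fiber become close in total variation.

    Two probabilities given by densities with respect to a common measure differ
    in total variation by twice their difference on the set [B] where the first
    density dominates (lemma [defect_gap]).  Let [u z] be the mass that the
    [n]-th average started at [z] gives to [B].  The defect at [g] is then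
    [2 * (u (unit) - u g)], and, the averages being telescopic, [u] is harmonic
    up to [1 / n.+1] (lemma [average_approx_harmonic]).  If the defect at [g] did
    not tend to [0], there would be functions with values in [0, 1], harmonic up
    to arbitrarily small errors, whose values at [g] and at the unit differ by a
    fixed amount.  Lemma [harmonic_limit] extracts from them a function that is
    exactly harmonic at every point of the fiber and keeps the gap.  By the
    Liouville property it is constant almost everywhere on the fiber; being the
    average of itself against measures absolutely continuous with respect to
    [lam], it is constant everywhere on the fiber, a contradiction.  Hence the
    defects, which are at most [2], tend to [0] at every point of almost every
    fiber, and dominated convergence concludes.

    The limit in [harmonic_limit] is obtained from convexity: approximately
    harmonic functions with a gap form convex sets, and near-minimizers of the
    quadratic mean over a decreasing sequence of convex sets form a Cauchy
    sequence.  This replaces weak-* compactness and the duality between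
    integrable and bounded functions.

    Borel measurability is handled through densities.  An adapted system is a
    jointly Borel function [D] for which the measures [D (z, .) lam^(tgt z)] are
    probabilities compatible with translations (definition [markov_density]);
    this class contains the densities of adapted systems, is stable under
    composition of kernels and under averages, and each of its members gives
    back an adapted system.  Properness of [lam] writes it as a countable sum of
    bounded kernels, so integrals along the fibers are Borel in the base point. *)

Set Implicit Arguments.
Unset Strict Implicit.
Unset Printing Implicit Defensive.

Local Open Scope classical_set_scope.
Local Open Scope ring_scope.

(** * Limits of approximately harmonic functions *)

Lemma summable_increments_cvg (R : realType) (v : R^nat) :
  (\sum_(k <oo) `|v k.+1 - v k|%:E < +oo)%E -> cvgn v.
Proof.
move=> vfin.
have cvgS : cvgn [normed series (telescope v)].
  apply: nondecreasing_is_cvgn.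
    apply/nondecreasing_seqP => n.
    by rewrite /= seriesSr lerDl normr_ge0.
  exists (fine (\sum_(k <oo) `|v k.+1 - v k|%:E)%E) => _ [n _ <-].
  have s0 : (0 <= \sum_(k <oo) `|v k.+1 - v k|%:E)%E.
    by apply: nneseries_ge0 => k _ _; rewrite lee_fin.
  rewrite -lee_fin fineK; last by rewrite ge0_fin_numE.
  rewrite /series/= -sumEFin.
  by apply: nneseries_lim_ge => k _ _; rewrite lee_fin.
have /normed_cvg := cvgS => cvT.
rewrite (_ : v = (fun n => v 0%N + series (telescope v) n)); last first.
  by apply/funext => n; rewrite (eq_sum_telescope v n).
by apply: is_cvgD => //; exact: is_cvg_cst.
Qed.

Section energy.
Context (R : realType) (d : measure_display) (T : measurableType d).

Lemma bounded_integrable (m : {finite_measure set T -> \bar R}) (u : T -> R)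
    (c : R) :
  measurable_fun setT u -> (forall y, `|u y| <= c) ->
  m.-integrable setT (EFin \o u).
Proof.
move=> mu uc; apply: measurable_bounded_integrable => //.
- by rewrite ltey_eq fin_num_measure.
- exists c; split; first by rewrite num_real.
  by move=> x cx y _ /=; exact: le_trans (uc y) (ltW cx).
Qed.

Definition in_unit_interval (u : T -> R) : Prop :=
  measurable_fun setT u /\ forall y, 0 <= u y <= 1.

Lemma in_unit_interval_integrable (m : {finite_measure set T -> \bar R}) u :
  in_unit_interval u -> m.-integrable setT (EFin \o u).
Proof.
move=> [mu u01]; apply: (@bounded_integrable _ _ 1) => // y.
by have /andP[? ?] := u01 y; rewrite ger0_norm.
Qed.

Definition energy (m : {measure set T -> \bar R}) (u : T -> R) : R :=
  \int[m]_y (u y ^+ 2).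

Lemma parallelogram (m : {finite_measure set T -> \bar R}) u v :
  in_unit_interval u -> in_unit_interval v ->
  energy m (fun y => u y - v y) =
    2 * energy m u + 2 * energy m v - 4 * energy m (fun y => (u y + v y) / 2).
Proof.
move=> [mu u01] [mv v01].
have uv y := conj (andP (u01 y)) (andP (v01 y)).
have iu : m.-integrable setT (EFin \o (fun y => u y ^+ 2)).
  apply: (@bounded_integrable _ _ 1); first (by apply: measurable_funX).
  by move=> y; have [[? ?] _] := uv y; rewrite ger0_norm ?sqr_ge0// exprn_ile1.
have iv : m.-integrable setT (EFin \o (fun y => v y ^+ 2)).
  apply: (@bounded_integrable _ _ 1); first (by apply: measurable_funX).
  by move=> y; have [_ [? ?]] := uv y; rewrite ger0_norm ?sqr_ge0// exprn_ile1.
have iw : m.-integrable setT (EFin \o (fun y => ((u y + v y) / 2) ^+ 2)).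
  apply: (@bounded_integrable _ _ 1).
    by apply: measurable_funX; apply: measurable_funM => //; exact: measurable_funD.
  move=> y; have [[? ?] [? ?]] := uv y; rewrite ger0_norm ?sqr_ge0// exprn_ile1//.
    by apply: divr_ge0 => //; lra.
  by rewrite ler_pdivrMr//; lra.
rewrite /energy.
rewrite (_ : (fun y => (u y - v y) ^+ 2) = (fun y =>
   (2 * u y ^+ 2 + 2 * v y ^+ 2) - 4 * ((u y + v y) / 2) ^+ 2)); last first.
  by apply/funext => y; field.
have e1 (f : T -> R) k : m.-integrable setT (EFin \o f) ->
    m.-integrable setT (EFin \o (fun y => k * f y)).
  by move=> i; exact: (integrableZl measurableT k i).
rewrite RintegralB//; last 2 first.
- by apply: (integrableD measurableT (e1 _ 2 iu) (e1 _ 2 iv)).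
- exact: e1.
rewrite RintegralD//; [|exact: e1|exact: e1].
by rewrite !RintegralZl.
Qed.

(** As [|t| <= 2^-k + 2^k t^2], increments with square-integral at most [4^-k]
    have integrals of order [2^-k], so the sum of their absolute values is
    integrable, hence finite almost everywhere. *)
Lemma energy_increments_cvg (m : {finite_measure set T -> \bar R})
    (w : (T -> R)^nat) :
  (forall k, in_unit_interval (w k)) ->
  (forall k, energy m (fun y => w k.+1 y - w k y) <= (4 ^+ k)^-1) ->
  {ae m, forall y, cvgn (w ^~ y)}.
Proof.
move=> wU wE.
pose f k y := `|w k.+1 y - w k y|%:E : \bar R.
have mw k : measurable_fun setT (w k.+1 \- w k).
  by apply: measurable_funB; have [] := wU k; have [] := wU k.+1.
have mf k : measurable_fun setT (f k).
  by apply/measurable_EFinP; apply: measurableT_comp => //; exact: mw.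
have f0 k y : setT y -> (0 <= f k y)%E by rewrite lee_fin.
have mS : measurable_fun setT (fun y => \sum_(k <oo) f k y)%E.
  by apply: ge0_emeasurable_sum => // k y _ _; exact: f0.
pose c := fine (m setT) + 1.
have fc k : (\int[m]_y f k y <= (c / 2 ^+ k)%:E)%E.
  have w1 y : `|w k.+1 y - w k y| <= 1.
    have [_ /(_ y)/andP[? ?]] := wU k; have [_ /(_ y)/andP[? ?]] := wU k.+1.
    by rewrite ler_norml; lra.
  have i2 : m.-integrable setT (EFin \o (fun y => (w k.+1 y - w k y) ^+ 2)).
    apply: (@bounded_integrable _ _ 1); first by apply: measurable_funX; exact: (mw k).
    by move=> y; rewrite normrX exprn_ile1.
  have i1 : m.-integrable setT (EFin \o (fun y => `|w k.+1 y - w k y|)).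
    apply: (@bounded_integrable _ _ 1); last by move=> y; rewrite normr_id.
    by apply: measurableT_comp => //; apply: (mw k).
  have -> : (\int[m]_y f k y)%E = (\int[m]_y `|w k.+1 y - w k y|)%:E.
    by rewrite fineK//; exact: integrable_fin_num.
  have ic : m.-integrable setT (EFin \o (fun=> (2 ^+ k)^-1 : R)).
    by apply: (@bounded_integrable _ _ `|(2 ^+ k)^-1|).
  have i3 : m.-integrable setT
      (EFin \o (fun y => 2 ^+ k * (w k.+1 y - w k y) ^+ 2)).
    exact: (integrableZl measurableT (2 ^+ k) i2).
  rewrite lee_fin; apply: (@le_trans _ _
      (\int[m]_y ((2 ^+ k)^-1 + 2 ^+ k * (w k.+1 y - w k y) ^+ 2))).
    apply: le_Rintegral => //; first exact: (integrableD measurableT ic i3).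
    move=> y _; rewrite -[(_ - _) ^+ 2]real_normK ?num_real//.
    set t := `| _ |; have t0 : 0 <= t by exact: normr_ge0.
    have p0 : 0 < 2 ^+ k :> R by exact: exprn_gt0.
    have [h|h] := leP t (2 ^+ k)^-1.
      by rewrite -[leLHS]addr0 lerD// mulr_ge0// ?sqr_ge0// ltW.
    rewrite -[leLHS]add0r; apply: lerD; first by rewrite invr_ge0 ltW.
    rewrite expr2 mulrA -[leLHS]mul1r ler_wpM2r//.
    by rewrite -ler_pdivrMl// mulr1 ltW.
  rewrite RintegralD// RintegralZl// Rintegral_cst//.
  have := wE k; rewrite /energy => h.
  rewrite /c mulrDl mul1r mulrC lerD//.
  apply: le_trans (ler_wpM2l _ h) _; first exact: exprn_ge0.
  rewrite (_ : 4 = 2 * 2)//; last by rewrite -natrM.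
  by rewrite exprMn invfM mulrA divff ?mul1r// gt_eqF// exprn_gt0.
have S0 y : (0 <= \sum_(k <oo) f k y)%E by apply: nneseries_ge0 => k _ _; exact: f0.
have S1 : (\int[m]_y (\sum_(k <oo) f k y) < +oo)%E.
  rewrite integral_nneseries//.
  apply: (@le_lt_trans _ _ (\sum_(k <oo) (c / (2 ^ k)%:R)%:E)%E).
    apply: lee_nneseries => k _; last by rewrite natrX.
    by move=> _; apply: integral_ge0 => y _; exact: f0.
  have c0 : 0 <= c by rewrite addr_ge0// fine_ge0.
  apply: (@le_lt_trans _ _ (2 * c)%:E); last by rewrite ltry.
  have c20 : 0 <= 2 * c by rewrite mulr_ge0.
  apply: le_trans (epsilon_trick0 xpredT c20).
  apply: lee_nneseries => k _.
    by move=> _; rewrite lee_fin divr_ge0.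
  by rewrite lee_fin expnS natrM invfM mulrACA divff// mul1r.
have iS : m.-integrable setT (fun y => \sum_(k <oo) f k y)%E.
  apply/integrableP; split => //.
  rewrite (eq_integral (fun y => \sum_(k <oo) f k y)%E)// => y _.
  by rewrite gee0_abs.
have := integrable_ae measurableT iS; apply: filterS => y /(_ I) yfin.
apply: summable_increments_cvg.
by move: yfin; rewrite ge0_fin_numE.
Qed.

End energy.

(** The sets of admissible [u] are midpoint-convex and decrease with [n].
    Near-minimizers of the energy over them are close to each other in quadratic
    mean, by the parallelogram law, so a sequence of them converges almost
    everywhere.  Being nearly harmonic, its value at a point [z] of [F] is close
    to its integral against [K z], which converges; so it converges at every
    point of [F], to a function that is exactly harmonic there. *)
Lemma harmonic_limit (R : realType) (d : measure_display)
    (T : measurableType d) (m : {finite_measure set T -> \bar R})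
    (F : set T) (K : T -> probability T R) (a b : T) (eps : R) :
  (forall z, F z -> K z `<< m) -> F a -> F b ->
  (forall n : nat, exists u : T -> R, [/\ in_unit_interval u,
     forall z, F z -> `|\int[K z]_y u y - u z| <= n.+1%:R^-1
     & eps <= u a - u b]) ->
  exists H : T -> R, [/\ in_unit_interval H,
     forall z, F z -> \int[K z]_y H y = H z
     & eps <= H a - H b].
Proof.
move=> Km Fa Fb Cne.
pose C n := [set u : T -> R | [/\ in_unit_interval u,
     forall z, F z -> `|\int[K z]_y u y - u z| <= n.+1%:R^-1
     & eps <= u a - u b]].
have Cdec n k u : (n <= k)%N -> C k u -> C n u.
  move=> nk [u1 u2 u3]; split => // z /u2 /le_trans; apply.
  by rewrite lef_pV2 ?posrE// ler_nat ltnS.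
have Cmid n u v : C n u -> C n v -> C n (fun y => (u y + v y) / 2).
  move=> [u1 u2 u3] [v1 v2 v3].
  have w1 : in_unit_interval (fun y => (u y + v y) / 2).
    split.
      apply: measurable_funM => //.
      by apply: measurable_funD; [exact: u1.1|exact: v1.1].
    move=> y; have := u1.2 y; have := v1.2 y => /andP[? ?] /andP[? ?].
    by apply/andP; split; lra.
  split => //; last by move: u3 v3; lra.
  move=> z Fz.
  have -> : \int[K z]_y ((u y + v y) / 2) =
      (\int[K z]_y u y + \int[K z]_y v y) / 2.
    have iu := in_unit_interval_integrable (K z) u1.
    have iv := in_unit_interval_integrable (K z) v1.
    rewrite RintegralZr//; last exact: (integrableD measurableT iu iv).
    by rewrite RintegralD.
  have := u2 z Fz; have := v2 z Fz; rewrite !ler_norml.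
  move: (n.+1%:R^-1) (\int[K z]_y u y) (\int[K z]_y v y) => c s t.
  by move=> /andP[? ?] /andP[? ?]; apply/andP; split; lra.
pose e n := inf [set energy m u | u in C n].
have E0 u : 0 <= energy m u by apply: Rintegral_ge0 => y _; exact: sqr_ge0.
have Einf n : has_inf [set energy m u | u in C n].
  split; last by exists 0 => _ [u _ <-].
  by have [u Cu] := Cne n; exists (energy m u), u.
have eE n u : C n u -> e n <= energy m u.
  by move=> Cu; apply: ge_inf; [exact: (Einf n).2|exists u].
have e_mono n k : (n <= k)%N -> e n <= e k.
  move=> nk; apply: lb_le_inf; first exact: (Einf k).1.
  by move=> _ [u Cu <-]; apply: eE; exact: Cdec Cu.
have Ele1 u : in_unit_interval u -> energy m u <= fine (m setT).
  move=> u1; rewrite /energy -[leRHS]mul1r -(Rintegral_cst m measurableT 1).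
  have u01 y : 0 <= u y <= 1 by exact: u1.2.
  apply: le_Rintegral => //.
  - apply: (@bounded_integrable _ _ _ _ _ 1); first by apply: measurable_funX; exact: u1.1.
    move=> y; have /andP[? ?] := u01 y.
    by rewrite ger0_norm ?sqr_ge0// exprn_ile1.
  - by apply: (@bounded_integrable _ _ _ _ _ `|1|).
  - by move=> y _; have /andP[? ?] := u01 y; rewrite exprn_ile1.
pose dd := sup (range e).
have esup : has_sup (range e).
  split; first by exists (e 0%N), 0%N.
  exists (fine (m setT)) => _ [n _ <-].
  by have [u Cu] := Cne n; apply: le_trans (eE _ _ Cu) _; apply: Ele1; case: Cu.
have edd n : e n <= dd by apply: ub_le_sup; [exact: esup.2|exists n].
(* The constant 8 absorbs the coefficients of the parallelogram law. *)
pose eta k : R := (4 ^+ k)^-1 / 8.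
have eta0 k : 0 < eta k by rewrite divr_gt0// invr_gt0 exprn_gt0.
have etaS k : eta k.+1 <= eta k.
  rewrite ler_wpM2r// lef_pV2 ?posrE ?exprn_gt0// exprS.
  by rewrite ler_peMl// ?exprn_ge0//; lra.
have step k : exists p : nat * (T -> R), [/\ (k <= p.1)%N, C p.1 p.2,
    dd - eta k < e p.1 & energy m p.2 < dd + eta k].
  have [_ [n _ <-] en] := @sup_adherent _ _ (eta k) (eta0 k) esup.
  have [_ [u Cu <-] eu] := @inf_adherent _ _ (eta k) (eta0 k) (Einf (maxn k n)).
  exists (maxn k n, u); split => //=; first by rewrite leq_maxl.
  - by apply: lt_le_trans en _; apply: e_mono; rewrite leq_maxr.
  - by apply: lt_le_trans eu _; rewrite lerD2r; exact: edd.
have [p pP] := choice step.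
pose w k := (p k).2.
have wU k : in_unit_interval (w k) by have [_ [? _ _] _ _] := pP k.
have wE k : energy m (fun y => w k.+1 y - w k y) <= (4 ^+ k)^-1.
  rewrite parallelogram//.
  have [_ C1 e1 E1] := pP k; have [_ C2 e2 E2] := pP k.+1.
  (* The midpoint belongs to the larger of the two sets involved. *)
  have mid : dd - eta k <= energy m (fun y => (w k.+1 y + w k y) / 2).
    have [le12|/ltnW le21] := leqP (p k).1 (p k.+1).1.
      apply: le_trans (ltW e1) _; apply: eE.
      by apply: Cmid => //; exact: Cdec C2.
    apply: (@le_trans _ _ (e (p k.+1).1)).
      by apply: ltW; apply: le_lt_trans e2; rewrite lerD2l lerN2.
    by apply: eE; apply: Cmid => //; exact: Cdec C1.
  rewrite -/(w k) -/(w k.+1) in E1 E2.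
  have := etaS k; move: E1 E2 mid; rewrite {3 5}/eta.
  have -> : (4 ^+ k)^-1 = 8 * eta k :> R by rewrite /eta; field.
  by lra.
have wcvg := energy_increments_cvg wU wE.
(* Truncating gives the bounds at once and does not change limits of [w]. *)
pose H y := Num.min 1 (Num.max 0 (fine (limn_esup (fun k => (w k y)%:E)))).
have HU : in_unit_interval H.
  split.
    apply: measurable_minr => //; apply: measurable_maxr => //.
    apply: measurableT_comp => //.
    apply: measurable_fun_limn_esup => k; apply/measurable_EFinP.
    exact: (wU k).1.
  move=> y; rewrite /H le_min ler01 le_max lexx/=.
  by rewrite ge_min lexx.
have Hlim y l : w ^~ y @ \oo --> l -> H y = l.
  move=> wl.
  have l01 : 0 <= l <= 1.
    apply/andP; split.
      rewrite -(cvg_lim _ wl)//; apply: limr_ge; first by apply/cvg_ex; exists l.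
      by apply: nearW => k; have /andP[] := (wU k).2 y.
    rewrite -(cvg_lim _ wl)//; apply: limr_le; first by apply/cvg_ex; exists l.
    by apply: nearW => k; have /andP[] := (wU k).2 y.
  rewrite /H.
  have wlE : (fun k => (w k y)%:E) @ \oo --> l%:E by apply: cvg_EFin wl; exact: nearW.
  rewrite is_cvg_limn_esupE; last by apply/cvg_ex; exists l%:E.
  rewrite (cvg_lim _ wlE)//=.
  by case/andP: l01 => ? ?; rewrite max_r// min_r.
have KwH z : F z -> (fun k => \int[K z]_y w k y) @ \oo --> \int[K z]_y H y.
  move=> Fz.
  have ae_cvg : {ae K z, forall y, setT y -> (fun k => (w k y)%:E) @ \oo --> (H y)%:E}.
    have : {ae K z, forall y, cvgn (w ^~ y)}.
      case: wcvg => N [mN N0 sN]; exists N; split => //.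
      by have /null_content_dominatesP Kzm := Km z Fz; exact: Kzm.
    apply: filterS => y /cvg_ex[l wl] _.
    by rewrite (Hlim _ _ wl); apply: cvg_EFin; [exact: nearW|exact: wl].
  have w1 : {ae K z, forall y k, setT y -> (`|(w k y)%:E| <= 1%E)%E}.
    apply: aeW => y k _; have /andP[? ?] := (wU k).2 y.
    by rewrite abse_EFin lee_fin ger0_norm.
  have [_ _] := @dominated_convergence _ _ _ (K z) _ measurableT
    (fun k y => (w k y)%:E) (fun y => (H y)%:E) (fun=> 1%E)
    (fun k => (measurable_EFinP _ _).2 (wU k).1)
    ((measurable_EFinP _ _).2 HU.1) ae_cvg
    (finite_measure_integrable_cst (K z) 1 measurableT) w1.
  move=> h; apply: fine_cvg; rewrite fineK//.
  exact: integrable_fin_num (in_unit_interval_integrable (K z) HU).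
have wz z : F z -> w ^~ z @ \oo --> \int[K z]_y H y.
  move=> Fz; apply/(cvg_sub0 _ (KwH z Fz)).
  apply/norm_cvg0P; apply: (squeeze_cvgr _ (cvg_cst 0) cvg_harmonic).
  apply: nearW => k; rewrite normr_ge0/=; have [kp [_ pz _] _ _] := pP k.
  rewrite /= distrC; apply: le_trans (pz z Fz) _.
  by rewrite /harmonic/= lef_pV2 ?posrE// ler_nat ltnS.
exists H; split => //.
  by move=> z Fz; rewrite (Hlim _ _ (wz z Fz)).
rewrite (Hlim _ _ (wz a Fa)) (Hlim _ _ (wz b Fb)).
have wab : (fun k => w k a - w k b) @ \oo -->
    \int[K a]_y H y - \int[K b]_y H y by apply: cvgB; exact: wz.
rewrite -(cvg_lim _ wab)//; apply: limr_ge; first by apply: cvgP wab.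
by apply: nearW => k; have [_ [_ _ ?] _ _] := pP k.
Qed.

(** * Measures given by densities *)

(** On a countable cover by sets of finite measure, positive weights make the
    sum of the weighted restrictions finite without creating null sets. *)
Lemma dominating_finite_measure (R : realType) (d : measure_display)
    (T : measurableType d) (lam : {measure set T -> \bar R}) :
  sigma_finite setT lam -> exists m : {finite_measure set T -> \bar R}, lam `<< m.
Proof.
move=> [F TF mF].
have Ffin n : lam (F n) \is a fin_num by rewrite ge0_fin_numE// (mF n).2.
pose r n : R := ((2 ^ n.+1)%:R * (1 + fine (lam (F n))))^-1.
have r_gt0 n : 0 < r n.
  by rewrite invr_gt0 mulr_gt0// ?ltr0n ?expn_gt0// ltr_wpDr// fine_ge0.
pose mm n : {measure set T -> \bar R} :=
  mscale (NngNum (ltW (r_gt0 n))) (mrestr lam (mF n).1).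
have mmE n A : mm n A = ((r n)%:E * lam (A `&` F n))%E by [].
pose m : {measure set T -> \bar R} := mseries mm 0.
have mfin : fin_num_fun m.
  move=> A mA; rewrite ge0_fin_numE//.
  apply: (@le_lt_trans _ _ 1%E); last by rewrite ltry.
  apply: le_trans (epsilon_trick0 xpredT (@ler01 R)).
  apply: lee_nneseries => n _; first by move=> _; exact: measure_ge0.
  rewrite mmE; apply: (@le_trans _ _ ((r n)%:E * (1 + fine (lam (F n)))%:E)%E).
    apply: lee_wpmul2l; first by rewrite lee_fin ltW.
    apply: (@le_trans _ _ (lam (F n))).
      have mFn := (mF n).1.
      by apply: le_measure; rewrite ?inE//; exact: measurableI.
    by rewrite EFinD fineK// leeDr.
  rewrite -EFinM lee_fin /r invfM -mulrA mulVf ?mulr1; last first.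
    by rewrite gt_eqF// ltr_wpDr// fine_ge0.
  by rewrite div1r.
pose mf : {finite_measure set T -> \bar R} :=
  HB.pack (m : set T -> \bar R) (Measure.on m)
    (Measure_isFinite.Build _ _ _ (m : set T -> \bar R) mfin).
exists mf; apply/null_content_dominatesP => A mA mA0.
have zero n : lam (A `&` F n) = 0%E.
  have : (mm n A <= 0)%E.
    rewrite -mA0 /mf/= /m /mseries.
    have := @nneseries_lim_ge R (mm ^~ A) xpredT 0%N n.+1 (fun k _ _ => measure_ge0 _ _).
    apply: le_trans; rewrite big_nat_recr//= leeDr//.
    by apply: sume_ge0 => k _; exact: measure_ge0.
  rewrite mmE pmule_rle0 ?lte_fin// => le0.
  by apply/eqP; rewrite eq_le le0 measure_ge0.
rewrite -(setIT A) TF setI_bigcupr; apply/eqP; rewrite eq_le measure_ge0 andbT.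
apply: le_trans (measure_sigma_subadditive _ _ _ (@subset_refl _ _)) _.
- by move=> n; apply: measurableI => //; exact: (mF n).1.
- by apply: bigcupT_measurable => n; apply: measurableI => //; exact: (mF n).1.
- by rewrite eseries0// => n _ _; exact: zero.
Qed.

(** Monotonicity matters when [c = +oo] and [l = 0]: it forces [u = 0]. *)
Lemma cvge_nondecreasingMr (R : realType) (u : (\bar R)^nat) (l c : \bar R) :
  (forall n, 0 <= u n)%E -> {homo u : n k / (n <= k)%N >-> (n <= k)%E} ->
  u @ \oo --> l -> (0 <= c)%E -> (fun n => u n * c)%E @ \oo --> (l * c)%E.
Proof.
move=> u0 nu ul c0.
have [cfin|] := boolP (c \is a fin_num); first by apply: cvgeZr.
rewrite ge0_fin_numE// -leNgt leye_eq => /eqP ->.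
have ule n : (u n <= l)%E.
  rewrite -(cvg_lim _ ul)// (cvg_lim _ (ereal_nondecreasing_cvgn nu))//.
  by apply: ereal_sup_ubound; exists n.
have : (0 <= l)%E by exact: le_trans (u0 0%N) (ule 0%N).
rewrite le_eqVlt => /predU1P[l0|l0].
  rewrite -l0 mul0e; apply: cvg_near_cst; apply: nearW => n.
  have := ule n; rewrite -l0 => un.
  by rewrite (_ : u n = 0%E) ?mul0e//; apply/le_anti; rewrite un u0.
have [n un] : exists n, (0 < u n)%E.
  apply/not_existsP => un; have : (l <= 0)%E; last by rewrite leNgt l0.
  rewrite -(cvg_lim _ ul)//; apply: lime_le; first by apply: cvgP ul.
  by apply: nearW => n; rewrite leNgt; apply/negP; exact: un.
apply: cvg_near_cst; exists n => // k /= nk.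
by rewrite !gt0_muley// (lt_le_trans un)// nu.
Qed.

Section mdensity.
Context (R : realType) (d : measure_display) (T : measurableType d).
Variables (m : {measure set T -> \bar R}) (p : T -> \bar R).
Hypotheses (mp : measurable_fun setT p) (p0 : forall y, (0 <= p y)%E).

(** The hypotheses are arguments so that the measure structure can be inferred. *)
Definition mdensity of measurable_fun setT p & (forall y, (0 <= p y)%E) :
  set T -> \bar R := fun A => (\int[m]_(y in A) p y)%E.

Let mu := mdensity mp p0.

Let mu_0 : mu set0 = 0%E. Proof. by rewrite /mu/mdensity integral_set0. Qed.

Let mu_ge0 A : (0 <= mu A)%E. Proof. exact: integral_ge0. Qed.

Let mu_sigma : semi_sigma_additive mu.
Proof. exact: semi_sigma_additive_nng_induced. Qed.

HB.instance Definition _ := isMeasure.Build _ _ _ (mdensity mp p0)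
  mu_0 mu_ge0 mu_sigma.

Import HBNNSimple.

Lemma ge0_integral_mdensity (f : T -> \bar R) :
  measurable_fun setT f -> (forall y, 0 <= f y)%E ->
  (\int[mdensity mp p0]_y f y = \int[m]_y (f y * p y))%E.
Proof.
move=> mf f0; pose h := nnsfun_approx measurableT mf.
have hn n k y : (n <= k)%N -> ((h n y)%:E <= (h k y)%:E)%E.
  by move=> nk; rewrite lee_fin; exact/lefP/nd_nnsfun_approx.
have h0 n y : (0 <= (h n y)%:E)%E by rewrite lee_fin.
have mh n : measurable_fun setT (EFin \o h n) by exact/measurable_EFinP.
have hf y : (EFin \o h ^~ y) @ \oo --> f y by exact: cvg_nnsfun_approx.
have eqh n : (\int[mdensity mp p0]_y (h n y)%:E = \int[m]_y ((h n y)%:E * p y))%E.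
  transitivity (\int[mdensity mp p0]_y
     (\sum_(r \in range (h n)) (r * \1_(h n @^-1` [set r]) y)%:E))%E.
    by apply: eq_integral => t tE; rewrite /= fimfunE -fsumEFin.
  have indich r : measurable_fun setT (fun y => (r * \1_(h n @^-1` [set r]) y)%:E).
    by apply: (measurable_comp measurableT) => //; exact: measurable_funM.
  rewrite ge0_integral_fsum//; last by move=> r y _; exact: nnfun_muleindic_ge0.
  transitivity (\int[m]_y (\sum_(r \in range (h n))
      (r * \1_(h n @^-1` [set r]) y)%:E * p y))%E; last first.
    apply: eq_integral => y _.
    rewrite -ge0_mule_fsuml => [|r]; last exact: nnfun_muleindic_ge0.
    by rewrite fsumEFin // -(fimfunE _ y).
  rewrite ge0_integral_fsum//; last 2 first.
  - by move=> r; exact: emeasurable_funM.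
  - by move=> r y _; rewrite mule_ge0// nnfun_muleindic_ge0.
  apply: eq_fsbigr => r; rewrite inE => -[t _ hr].
  have r0 : 0 <= r by rewrite -hr.
  have mr : measurable (h n @^-1` [set r]) by exact: measurable_sfunP.
  under eq_integral do rewrite EFinM.
  rewrite integralZl_indic_nnsfun// integral_indic// setIT.
  under [RHS]eq_integral do rewrite EFinM -muleA.
  rewrite ge0_integralZl//; last 2 first.
  - by apply: emeasurable_funM => //; exact/measurable_EFinP.
  - by move=> y _; rewrite mule_ge0// lee_fin.
  congr (_ * _)%E; rewrite /mdensity [LHS]integral_mkcond.
  by apply: eq_integral => y _; rewrite epatch_indic muleC.
transitivity (limn (fun n => \int[mdensity mp p0]_y (h n y)%:E))%E.
  apply/esym/cvg_lim => //.
  rewrite (eq_integral (fun y => limn (EFin \o h ^~ y))); last first.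
    by move=> y _; apply/esym/cvg_lim => //; exact: hf.
  by apply: cvg_monotone_convergence => // y _ a b ab; exact: hn.
under eq_fun do rewrite eqh.
apply/cvg_lim => //.
rewrite (eq_integral (fun y => limn (fun n => (h n y)%:E * p y)))%E; last first.
  move=> y _; apply/esym/cvg_lim => //; apply: cvge_nondecreasingMr => //.
  - by move=> a b ab; exact: hn.
  - exact: hf.
apply: cvg_monotone_convergence => //.
- by move=> n; exact: emeasurable_funM (mh n) mp.
- by move=> n y _; exact: mule_ge0.
- by move=> y _ a b ab; apply: lee_wpmul2r => //; exact: hn.
Qed.

End mdensity.

Section densities.
Local Open Scope ereal_scope.
Context (R : realType) (d : measure_display) (T : measurableType d).

Lemma measurable_slice (D : T * T -> \bar R) z :
  measurable_fun setT D -> measurable_fun setT (fun e => D (z, e)).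
Proof. by move=> mD; exact: measurableT_comp mD (measurable_pair1 z). Qed.

Lemma ge0_integral_density (m nu : {measure set T -> \bar R}) (p f : T -> \bar R) :
  measurable_fun setT p -> (forall e, 0 <= p e) ->
  (forall A, measurable A -> nu A = \int[m]_(e in A) p e) ->
  measurable_fun setT f -> (forall e, 0 <= f e) ->
  \int[nu]_e f e = \int[m]_e (f e * p e).
Proof.
move=> mp p0 nuE mf f0; rewrite -(ge0_integral_mdensity m mp p0 mf f0).
by apply: eq_measure_integral => A mA _; rewrite nuE.
Qed.

Lemma density_probability (m : {measure set T -> \bar R}) (p : T -> \bar R) :
  measurable_fun setT p -> (forall e, 0 <= p e) -> \int[m]_e p e = 1 ->
  exists P : probability T R, forall A, measurable A -> P A = \int[m]_(e in A) p e.
Proof.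
move=> mp p0 p1.
pose P : probability T R := HB.pack (mdensity m mp p0)
  (Measure_isProbability.Build _ _ _ (mdensity m mp p0) p1).
by exists P.
Qed.

Lemma integral_indicM (m : {measure set T -> \bar R}) (p : T -> \bar R) A :
  \int[m]_(e in A) p e = \int[m]_e ((\1_A e)%:E * p e).
Proof.
rewrite integral_mkcond; apply: eq_integral => e _.
by rewrite epatch_indic muleC.
Qed.

Lemma measure_concentrated (nu : {measure set T -> \bar R}) (F A : set T) :
  measurable F -> nu (~` F) = 0 -> measurable A -> nu A = nu (A `&` F).
Proof.
move=> mF nuF mA; rewrite -[in LHS](setUIDK A F) measureU.
- rewrite [X in _ + X](_ : _ = 0) ?adde0//.
  apply/eqP; rewrite eq_le measure_ge0 andbT -nuF.
  by apply: le_measure; rewrite ?inE; [exact: measurableD|exact: measurableC|move=> e []].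
- exact: measurableI.
- exact: measurableD.
- by apply/seteqP; split => e // [[_ ?] [_ ?]].
Qed.

End densities.

(** * Total variation *)

Section total_variation_integral.
Context (R : realType) (d : measure_display) (T : measurableType d).
Variables (m : {measure set T -> \bar R}) (r : T -> \bar R).
Hypothesis ir : m.-integrable setT r.

Let B := [set y | (0 <= r y)%E].

Let mr : measurable_fun setT r. Proof. exact: measurable_int ir. Qed.

Let mB : measurable B.
Proof. by rewrite -[B]setTI; exact: emeasurable_fun_c_infty. Qed.

Let intB : (\int[m]_(y in B) `|r y| = \int[m]_(y in B) r y)%E.
Proof. by apply: eq_integral => y /[!inE] By; rewrite gee0_abs. Qed.

Let intBC : (\int[m]_(y in ~` B) `|r y| = - \int[m]_(y in ~` B) r y)%E.
Proof.
have rN y : (~` B) y -> (r y <= 0)%E by move=> /= /negP; rewrite -ltNge => /ltW.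
have -> : (\int[m]_(y in ~` B) r y = - \int[m]_(y in ~` B) - r y)%E.
  rewrite -integral_ge0N; last by move=> y /rN ?; rewrite oppe_ge0.
  by apply: eq_integral => y _; rewrite oppeK.
rewrite oppeK; apply: eq_integral => y; rewrite inE => /rN ry.
by rewrite lee0_abs.
Qed.

Let int_split (f : T -> \bar R) : measurable_fun setT f -> (forall y, 0 <= f y)%E ->
  (\int[m]_y f y = \int[m]_(y in B) f y + \int[m]_(y in ~` B) f y)%E.
Proof.
move=> mf f0; rewrite -ge0_integral_setU ?setUv//; first exact: measurableC.
by apply/disj_setPCl.
Qed.

(** The supremum is reached on the partition given by the sign of [r]. *)
Lemma total_variation_integral (nu : set T -> \bar R) :
  (forall A, measurable A -> nu A = \int[m]_(y in A) r y)%E ->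
  Defs.total_variation nu = (\int[m]_y `|r y|)%E.
Proof.
move=> nuE; have mabs : measurable_fun setT (fun y => `|r y|)%E.
  exact: measurableT_comp.
apply/eqP; rewrite eq_le; apply/andP; split.
  apply: ge_ereal_sup => _ [n [A [mA tA UA ->]]].
  apply: (@le_trans _ _ (\sum_(i < n) \int[m]_(y in A i) `|r y|)%E).
    apply: lee_sum => i _; rewrite nuE//; apply: le_abse_integral => //.
    exact: measurable_funTS.
  rewrite -ge0_integral_bigsetU//.
  - by apply: ge0_subset_integral => //; exact: bigsetU_measurable.
  - exact: index_enum_uniq.
  - exact: sub_trivIset tA.
  - exact: measurable_funTS.
rewrite int_split//.
apply: ereal_sup_ubound; exists 2%N, (fun i => if i == 0%N :> nat then B else ~` B).
split.
- by move=> i; case: ifP => // _; exact: measurableC.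
- apply/trivIsetP => -[[|[|//]] i2] [[|[|//]] j2] _ _ //=.
  + by move=> _; rewrite setICr.
  + by move=> _; rewrite setICl.
- apply/seteqP; split => // y _; have [By|nBy] := pselect (B y).
    by exists ord0.
  by exists ord_max.
rewrite !big_ord_recl big_ord0 adde0/= !nuE//; last exact: measurableC.
rewrite intB intBC; congr (_ + _)%E.
  by rewrite gee0_abs//; apply: integral_ge0 => y.
by rewrite -abseN gee0_abs// -intBC; exact: integral_ge0.
Qed.

Lemma integral_abs_mean0 : (\int[m]_y r y = 0)%E ->
  (\int[m]_y `|r y| = 2%:E * \int[m]_(y in B) r y)%E.
Proof.
move=> r0; rewrite int_split//; last exact: measurableT_comp.
have fB A : measurable A -> (\int[m]_(y in A) r y)%E \is a fin_num.
  by move=> mA; apply: integrable_fin_num => //; exact: integrableS ir.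
have rBC : (\int[m]_(y in ~` B) r y = - \int[m]_(y in B) r y)%E.
  have : (\int[m]_(y in B) r y + \int[m]_(y in ~` B) r y = 0)%E.
    rewrite -integral_setU ?setUv//; first exact: measurableC.
    by apply/disj_setPCl.
  have mBC := measurableC mB.
  rewrite -(fineK (fB _ mB)) -(fineK (fB _ mBC)) -EFinD -EFinN => -[h].
  by congr EFin; move: h; lra.
rewrite intB intBC rBC oppeK -(fineK (fB _ mB)) -EFinD -EFinM.
by congr EFin; rewrite mulr_natl mulr2n.
Qed.

End total_variation_integral.

(** * The diagonal of an analytic Borel space *)

(** Two distinct points are separated by a ball with center in the countable
    dense set and radius [n.+1^-1]; the complement of the diagonal is therefore
    a countable union of measurable rectangles. *)
Lemma measurable_diagonal (R : realType) (d : measure_display)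
    (T : measurableType d) :
  analytic_borel R T -> measurable [set p : T * T | p.1 = p.2].
Proof.
move=> [X [A [phi [[hX [D cD dD]] _ phiI _ mT]]]].
have [f finj] : exists f : X -> nat, {in D &, injective f} by exact/countable_injP.
(* By injectivity of [f] on [D], each of these unions has at most one term. *)
pose O k n : set X :=
  \bigcup_(q in [set q | D q /\ f q = k]) (ball q n.+1%:R^-1)°.
have oO k n : open (O k n) by apply: bigcup_open => q _; exact: open_interior.
have mU k n : measurable (phi @^-1` (O k n)).
  rewrite mT; exists (O k n); last by rewrite setTI.
  exact: sub_sigma_algebra (oO k n).
have sep x y : x <> y -> exists k n, (phi @^-1` (O k n)) x /\ ~ (phi @^-1` (O k n)) y.
  move=> xy; have pxy : phi x != phi y by apply/eqP => /phiI.
  move: hX; rewrite open_hausdorff => /(_ _ _ pxy)[[V W]/= [Vx Wy] [oV oW VW]].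
  have [e e0 eV] : exists2 e : R, 0 < e & ball (phi x) e `<=` V.
    have /nbhs_ballP[e /= e0 eV] : nbhs (phi x) V.
      by apply: open_nbhs_nbhs; split => //; rewrite inE in Vx.
    by exists e.
  have [n n0] : exists n : nat, n.+1%:R^-1 < e / 2.
    have := near_infty_natSinv_lt (PosNum (divr_gt0 e0 (ltr0Sn R 1))).
    by move=> [n _ /(_ n (leqnn n))] /= h; exists n.
  set r := n.+1%:R^-1 in n0; have r0 : 0 < r by rewrite invr_gt0.
  have r20 : 0 < r / 2 by rewrite divr_gt0.
  have [q [qx Dq]] : exists q, ball (phi x) (r / 2) q /\ D q.
    have /dD : (ball (phi x) (r / 2))° !=set0.
      by exists (phi x); exact: nbhsx_ballx.
    move=> /(_ (@open_interior _ _)) [q [? ?]]; exists q; split => //.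
    exact: interior_subset.
  exists (f q), n; split.
    exists q => //; apply/nbhs_ballP; exists (r / 2) => //= z xz.
    by rewrite -/r (splitr r); apply: ball_triangle xz; exact: ball_sym.
  move=> [q' [Dq' ff]] /interior_subset; rewrite -/r.
  have -> : q' = q by apply: finj; rewrite ?inE.
  move=> qy; have : V (phi y).
    apply: eV; apply: (@le_ball _ _ _ (r / 2 + r)); first by move: n0; lra.
    exact: ball_triangle qx qy.
  move=> Vy; have : (V `&` W) (phi y) by split => //; move: Wy; rewrite inE.
  by move/eqP : VW => ->.
have -> : [set p : T * T | p.1 = p.2] = ~` (\bigcup_k \bigcup_n
    (phi @^-1` (O k n) `*` ~` (phi @^-1` (O k n)))).
  apply/seteqP; split => [[x y] /= -> [k _ [n _ /= [? ?]]]//|[x y] /= h].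
  apply: contrapT => /sep[k [n [? ?]]]; apply: h.
  by exists k => //; exists n.
apply: measurableC; apply: bigcupT_measurable => k.
apply: bigcupT_measurable => n; apply: measurableX => //; exact: measurableC.
Qed.

Lemma measurable_singleton (R : realType) (d : measure_display)
    (T : measurableType d) (x : T) : analytic_borel R T -> measurable [set x].
Proof.
move=> /measurable_diagonal mD.
rewrite (_ : [set x] = xsection [set p : T * T | p.1 = p.2] x); last first.
  by apply/seteqP; split => y; rewrite /xsection/= inE/= => ->.
exact: measurable_xsection.
Qed.

(** * Integration along the fibers *)

Section finite_family.
Context (R : realType) (d d' : measure_display) (X : measurableType d)
  (Y : measurableType d') (k : X -> {measure set Y -> \bar R}).
Hypotheses (mk : forall U, measurable U -> measurable_fun setT (k ^~ U))
  (uk : measure_fam_uub k).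

(** The hypotheses are arguments so that the kernel structure can be inferred. *)
Definition finite_family of
  (forall U, measurable U -> measurable_fun setT (k ^~ U)) &
  measure_fam_uub k := k.

HB.instance Definition _ :=
  isKernel.Build _ _ _ _ _ (finite_family mk uk) mk.
HB.instance Definition _ :=
  Kernel_isFinite.Build _ _ _ _ _ (finite_family mk uk) uk.

Lemma measurable_integral_finite_family (f : X * Y -> \bar R) :
  measurable_fun setT f -> (forall p, (0 <= f p)%E) ->
  measurable_fun setT (fun x => \int[k x]_y f (x, y))%E.
Proof.
move=> mf f0.
exact: (measurable_fun_integral_finite_kernel f (finite_family mk uk)).
Qed.

End finite_family.

Section fibered_integrals.
Local Open Scope ereal_scope.
Context (R : realType) (d d0 : measure_display) (G : measurableType d)
  (G0 : measurableType d0).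
Variables (S : borel_semigroupoid R G G0) (lam : G0 -> {measure set G -> \bar R}).
Hypotheses (lam_borel : borel_system S lam) (lam_proper : proper_system lam).

Lemma measurable_fiber x : measurable (fiber S x).
Proof.
rewrite -[fiber S x]setTI; apply: (bs_measurable_tgt S) => //.
exact: measurable_singleton (bs_analytic_units S).
Qed.

Lemma measurable_unit_of : measurable_fun setT (unit_of S).
Proof. by move=> _ A mA; rewrite (bs_subspace S); exists A. Qed.

Lemma measurable_composable : measurable (composable S).
Proof.
have mD := measurable_diagonal (bs_analytic_units S).
rewrite (_ : composable S =
  setT `&` (fun p : G * G => (src S p.1, tgt S p.2)) @^-1`
    [set p : G0 * G0 | p.1 = p.2]); last by rewrite setTI.
have m : measurable_fun setT (fun p : G * G => (src S p.1, tgt S p.2)).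
  apply: measurable_fun_pair.
    exact: measurableT_comp (bs_measurable_src S) measurable_fst.
  exact: measurableT_comp (bs_measurable_tgt S) measurable_snd.
exact: m.
Qed.

(** Left multiplication by [z], extended by the identity outside the fiber on
    which it is defined, so as to be a measurable map on the whole space. *)
Definition lmul (z e : G) : G :=
  if `[< src S z = tgt S e >] then gcomp S z e else e.

Lemma lmulE z e : src S z = tgt S e -> lmul z e = gcomp S z e.
Proof. by rewrite /lmul => h; case: asboolP. Qed.

Lemma measurable_lmul_preimage z (A : set G) : measurable A ->
  measurable (fiber S (src S z) `&` gcomp S z @^-1` A).
Proof.
move=> mA.
have := bs_measurable_comp (b := S) measurable_composable mA.
move=> /(measurable_xsection z); congr measurable.
apply/seteqP; split => e; rewrite /xsection/= inE /composable /fiber /=.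
  by move=> [-> ?].
by move=> [-> ?].
Qed.

Lemma measurable_lmul z : measurable_fun setT (lmul z).
Proof.
move=> _ A mA; rewrite setTI.
rewrite (_ : lmul z @^-1` A = (fiber S (src S z) `&` gcomp S z @^-1` A) `|`
    (~` fiber S (src S z) `&` A)); last first.
  apply/seteqP; split => e; rewrite /lmul /fiber /=.
    by case: asboolP => h ?; [left|right]; split => //; exact/nesym.
  case: asboolP => h [[h1 h2]|[h1 h2]] //.
      by case: (h1 (esym h)).
    by case: (h (esym h1)).
apply: measurableU; first exact: measurable_lmul_preimage.
by apply: measurableI => //; apply: measurableC; exact: measurable_fiber.
Qed.

Lemma borel_system_measurable A :
  measurable A -> measurable_fun setT (fun x => lam x A).
Proof.
move=> mA; have [_ _ ml] := lam_borel.
rewrite (_ : (fun x => _) = (fun x => \int[lam x]_e (\1_A e)%:E)).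
  by apply: ml => [|e]; [exact/measurable_EFinP|rewrite lee_fin].
by apply/funext => x; rewrite integral_indic// setIT.
Qed.

Lemma eq_integral_fiber x (f g : G -> \bar R) :
  measurable_fun setT f -> measurable_fun setT g ->
  (forall e, 0 <= f e) -> (forall e, 0 <= g e) ->
  (forall e, tgt S e = x -> f e = g e) ->
  \int[lam x]_e f e = \int[lam x]_e g e.
Proof.
move=> mf mg f0 g0 fg; apply: ge0_ae_eq_integral => //.
have [_ lamF _] := lam_borel.
exists (~` fiber S x); split => //; first exact/measurableC/measurable_fiber.
by move=> e /=; apply: contra_not => Fe _; exact: fg.
Qed.

(** Properness cuts [lam] into countably many uniformly bounded kernels, and the
    integral is the sum of the integrals against the pieces. *)
Lemma measurable_integral_fiber (dX : measure_display) (X : measurableType dX)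
    (tau : X -> G0) (f : X * G -> \bar R) :
  measurable_fun setT tau -> measurable_fun setT f -> (forall p, 0 <= f p) ->
  measurable_fun setT (fun x => \int[lam (tau x)]_y f (x, y)).
Proof.
move=> mtau mf f0.
have [A [mA Amono UA Abnd]] := lam_proper.
have mB n : measurable (seqDU A n) by apply: seqDU_measurable.
pose k n x : {measure set G -> \bar R} := mrestr (lam (tau x)) (mB n).
have kE x U : measurable U -> lam (tau x) U = mseries (k ^~ x) 0 U.
  move=> mU; rewrite /mseries /= /mrestr -measure_semi_bigcup.
  - by rewrite -setI_bigcupr -seqDU_bigcup_eq UA setIT.
  - by move=> i; exact: measurableI.
  - apply/trivIsetP => i j _ _ ij.
    have /trivIsetP/(_ i j I I ij) h := @trivIset_seqDU _ A.
    by rewrite setIACA h setI0.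
  - by apply: bigcupT_measurable => i; exact: measurableI.
have mk n U : measurable U -> measurable_fun setT (k n ^~ U).
  move=> mU; have mUB : measurable (U `&` seqDU A n) by exact: measurableI.
  exact: measurableT_comp (borel_system_measurable mUB) mtau.
have ubk n : measure_fam_uub (k n).
  have [M bM] := Abnd n; exists (M + 1)%R => x.
  apply: (@le_lt_trans _ _ M%:E); last by rewrite lte_fin ltrDl.
  apply: le_trans (bM (tau x)); rewrite /k/= /mrestr setTI.
  by apply: le_measure; rewrite ?inE//; exact: subset_seqDU.
rewrite (_ : (fun _ => _) = (fun x => \sum_(n <oo) \int[k n x]_y f (x, y))).
  apply: ge0_emeasurable_sum => n; first by move=> *; exact: integral_ge0.
  by move=> _; exact: (measurable_integral_finite_family (mk n) (ubk n)).
apply/funext => x.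
rewrite (eq_measure_integral (mseries (k ^~ x) 0)); last by move=> U mU _; exact: kE.
rewrite ge0_integral_measure_series//.
exact: measurableT_comp.
Qed.

(** A function [D] on pairs stands for the family of measures
    [D (z, .) lam^(tgt z)].  The condition says that the measure at [z] is the
    translate by [z] of the measure at the unit over [src z], that is, that the
    family commutes with left translations. *)
Definition equivariant (D : G * G -> \bar R) : Prop :=
  forall z (f : G -> \bar R), measurable_fun setT f -> (forall e, 0 <= f e) ->
    \int[lam (src S z)]_e (f (lmul z e) * D (unit_of S (src S z), e)) =
    \int[lam (tgt S z)]_e (f e * D (z, e)).

Definition markov_density (D : G * G -> \bar R) : Prop :=
  [/\ measurable_fun setT D, forall p, 0 <= D p,
      forall z, \int[lam (tgt S z)]_e D (z, e) = 1 & equivariant D].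

End fibered_integrals.

(** * Densities of equivariant Markov kernels *)

Section markov_densities.
Local Open Scope ereal_scope.
Context (R : realType) (d d0 : measure_display) (G : measurableType d)
  (G0 : measurableType d0).
Variables (S : borel_semigroupoid R G G0) (lam : G0 -> {measure set G -> \bar R}).
Hypotheses (lam_borel : borel_system S lam) (lam_proper : proper_system lam).

Lemma translate_unit (nu : {measure set G -> \bar R}) x A :
  nu (~` fiber S x) = 0 -> measurable A -> translate S (unit_of S x) nu A = nu A.
Proof.
move=> nuF mA; rewrite /translate src_unit.
rewrite (measure_concentrated (measurable_fiber S x) nuF mA).
congr (nu _); apply/seteqP; split => e [].
  by move=> <- /= ; rewrite gcomp_unit_l.
by move=> Ae <-; split => //=; rewrite gcomp_unit_l.
Qed.

Lemma translate_pushforward (nu : {measure set G -> \bar R}) z A :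
  nu (~` fiber S (src S z)) = 0 -> measurable A ->
  translate S z nu A = nu (lmul S z @^-1` A).
Proof.
move=> nuF mA; have mF := measurable_fiber S (src S z).
have mL : measurable (lmul S z @^-1` A).
  by rewrite -[X in measurable X]setTI; exact: measurable_lmul.
rewrite (measure_concentrated mF nuF mL).
congr (nu _); apply/seteqP; split => e; rewrite /fiber/=.
  by move=> [h ?]; split => //; rewrite lmulE.
by move=> [+ h]; rewrite lmulE.
Qed.

(** Both sides of the equivariance identity are integrals against the translate
    of [pi (src z)] by [z], computed as a pushforward and through the density. *)
Lemma adapted_markov_density (pi : G0 -> probability G R) :
  adapted S lam pi -> exists2 D, markov_density S lam D &
  forall x A, measurable A -> pi x A = \int[lam x]_(e in A) D (unit_of S x, e).
Proof.
move=> [[_ piF _] _ [D [mD D0 DE]]].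
have unitE x A : measurable A -> pi x A = \int[lam x]_(e in A) D (unit_of S x, e).
  move=> mA; have := DE (unit_of S x) A mA.
  rewrite src_unit tgt_unit => <-.
  by rewrite translate_unit.
exists D => //; split => // [z|z f mf f0].
  rewrite -DE// (translate_pushforward (piF _))// preimage_setT.
  exact: probability_setT.
have [nu nuE] : exists nu : {measure set G -> \bar R},
    (nu : set G -> \bar R) = pushforward (pi (src S z)) (lmul S z).
  by exists (measure_function_pushforward__canonical__measure_function_Measure
    (pi (src S z)) (measurable_lmul S z)).
have mflz : measurable_fun setT (f \o lmul S z).
  exact: measurableT_comp mf (measurable_lmul S z).
transitivity (\int[pi (src S z)]_e (f \o lmul S z) e).
  apply/esym/(@ge0_integral_density _ _ _ (lam (src S z)) (pi (src S z))
    (fun e => D (unit_of S (src S z), e)) (f \o lmul S z)) => // [|A mA|e].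
  - exact: measurable_slice.
  - exact: unitE.
  - exact: f0.
transitivity (\int[nu]_e f e).
  by rewrite nuE ge0_integral_pushforward//; exact: measurable_lmul.
apply: (@ge0_integral_density _ _ _ _ nu (fun e => D (z, e)) f) => // [|A mA].
  exact: measurable_slice.
by rewrite nuE -DE// (translate_pushforward (piF _)).
Qed.

Lemma markov_density_translate (theta : G0 -> probability G R) D :
  markov_density S lam D ->
  (forall x A, measurable A ->
    theta x A = \int[lam x]_(e in A) D (unit_of S x, e)) ->
  forall z A, measurable A ->
    translate S z (theta (src S z)) A = \int[lam (tgt S z)]_(e in A) D (z, e).
Proof.
move=> [mD D0 D1 Deq] thetaE z A mA.
have [_ lamF _] := lam_borel.
have mF x := measurable_fiber S x.
have mp x := measurable_slice (unit_of S x) mD.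
have thetaF x : theta x (~` fiber S x) = 0.
  rewrite thetaE; last exact: measurableC.
  by apply: null_set_integral => //; [exact: measurableC|exact: measurable_funTS].
transitivity (theta (src S z) (lmul S z @^-1` A)).
  by apply: translate_pushforward => //; exact: thetaF.
rewrite thetaE; last first.
  by rewrite -[X in measurable X]setTI; exact: measurable_lmul.
rewrite (integral_indicM _ _ (lmul S z @^-1` A)).
rewrite [RHS](integral_indicM _ _ A) -Deq//; first exact/measurable_EFinP.
Qed.

Lemma markov_density_adapted (theta : G0 -> probability G R) D :
  markov_density S lam D ->
  (forall x A, measurable A ->
    theta x A = \int[lam x]_(e in A) D (unit_of S x, e)) ->
  adapted S lam theta.
Proof.
move=> DM thetaE; have [mD D0 D1 Deq] := DM.
have [_ lamF _] := lam_borel.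
have mp x := measurable_slice (unit_of S x) mD.
split; last by exists D; split => //; exact: markov_density_translate.
  split => [x|x|f mf f0]; first exact: sigma_finiteT.
    have mF := measurable_fiber S x.
    apply: (eq_trans (thetaE _ _ (measurableC mF))).
    by apply: null_set_integral => //; [exact: measurableC|exact: measurable_funTS].
  rewrite (_ : (fun x => _) =
      (fun x => \int[lam x]_e (f e * D (unit_of S x, e)))); last first.
    apply/funext => x.
    apply: (@ge0_integral_density _ _ _ _ (theta x) (fun e => D (unit_of S x, e))) => //.
    by move=> A; exact: thetaE.
  apply: (measurable_integral_fiber lam_borel lam_proper (tau := id)
    (f := fun p => f p.2 * D (unit_of S p.1, p.2))) => //.
    apply: emeasurable_funM; first exact: measurableT_comp mf measurable_snd.
    apply: measurableT_comp mD _; apply: measurable_fun_pair => //.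
    exact: measurableT_comp (measurable_unit_of S) measurable_fst.
  by move=> p; exact: mule_ge0.
move=> x; apply/null_content_dominatesP => A mA A0.
apply: (eq_trans (thetaE _ _ mA)).
by apply: null_set_integral => //; exact: measurable_funTS.
Qed.

End markov_densities.

(** * Composition of kernels *)

Section sigma_finite_tonelli.
Context (R : realType) (d : measure_display) (T : measurableType d).
Variable m : {measure set T -> \bar R}.
Hypothesis sm : sigma_finite setT m.

(** The hypothesis is an argument so that the s-finite structure needed by
    Tonelli's theorem can be inferred. *)
Definition sigma_finite_of of sigma_finite setT m : set T -> \bar R := m.

HB.instance Definition _ := Measure.on (sigma_finite_of sm).
HB.instance Definition _ :=
  Measure_isSigmaFinite.Build _ _ _ (sigma_finite_of sm) sm.

Lemma sigma_finite_tonelli (f : T * T -> \bar R) :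
  (forall p, 0 <= f p)%E -> measurable_fun setT f ->
  (\int[m]_x \int[m]_y f (x, y) = \int[m]_y \int[m]_x f (x, y))%E.
Proof.
move=> f0 mf.
exact: (sfinite_Fubini (sigma_finite_of sm) (sigma_finite_of sm) f f0 mf).
Qed.

End sigma_finite_tonelli.

Section convolution.
Local Open Scope ereal_scope.
Context (R : realType) (d d0 : measure_display) (G : measurableType d)
  (G0 : measurableType d0).
Variables (S : borel_semigroupoid R G G0) (lam : G0 -> {measure set G -> \bar R}).
Hypotheses (lam_borel : borel_system S lam) (lam_proper : proper_system lam).

(** Equivariance at an arbitrary [w] in place of a unit: both sides are
    translates of the measure at the unit over [src w], by associativity. *)
Lemma equivariant_gcomp D z w f : markov_density S lam D ->
  src S z = tgt S w -> measurable_fun setT f -> (forall e, 0 <= f e) ->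
  \int[lam (tgt S w)]_e (f (lmul S z e) * D (w, e)) =
  \int[lam (tgt S z)]_e (f e * D (gcomp S z w, e)).
Proof.
move=> [mD D0 _ Deq] zw mf f0.
have mfl u : measurable_fun setT (fun e => f (lmul S u e)).
  exact: measurableT_comp mf (measurable_lmul S u).
rewrite -(Deq w (fun e => f (lmul S z e)))//.
have := Deq (gcomp S z w) f mf f0.
rewrite src_gcomp// tgt_gcomp// => <-.
have mp := measurable_slice (unit_of S (src S w)) mD.
apply: (eq_integral_fiber lam_borel) => [| |e|e|e te].
- apply: emeasurable_funM mp.
  exact: measurableT_comp (mfl z) (measurable_lmul S w).
- exact: emeasurable_funM (mfl _) mp.
- exact: mule_ge0.
- exact: mule_ge0.
- rewrite [lmul S w e]lmulE// lmulE ?tgt_gcomp// lmulE ?src_gcomp//.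
  by rewrite gcomp_assoc.
Qed.

(** The density of the composition of the two kernels: first a step of [D],
    then a step of [E]. *)
Definition conv (D E : G * G -> \bar R) (p : G * G) : \bar R :=
  \int[lam (tgt S p.1)]_w (D (p.1, w) * E (w, p.2)).

Lemma measurable_conv D E : measurable_fun setT D -> (forall p, 0 <= D p) ->
  measurable_fun setT E -> (forall p, 0 <= E p) -> measurable_fun setT (conv D E).
Proof.
move=> mD D0 mE E0.
apply: (measurable_integral_fiber lam_borel lam_proper
  (tau := fun p : G * G => tgt S p.1)
  (f := fun q : (G * G) * G => D (q.1.1, q.2) * E (q.2, q.1.2))).
- exact: measurableT_comp (bs_measurable_tgt S) measurable_fst.
- apply: emeasurable_funM.
    apply: measurableT_comp mD _; apply: measurable_fun_pair => //.
    exact: measurableT_comp measurable_fst measurable_fst.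
  apply: measurableT_comp mE _; apply: measurable_fun_pair => //.
  exact: measurableT_comp measurable_snd measurable_fst.
- by move=> q; exact: mule_ge0.
Qed.

Lemma measurable_kernel_integral D f : measurable_fun setT D ->
  (forall p, 0 <= D p) -> measurable_fun setT f -> (forall e, 0 <= f e) ->
  measurable_fun setT (fun w => \int[lam (tgt S w)]_e (f e * D (w, e))).
Proof.
move=> mD D0 mf f0.
apply: (measurable_integral_fiber lam_borel lam_proper
  (tau := tgt S) (f := fun q => f q.2 * D q)).
- exact: (bs_measurable_tgt S).
- by apply: emeasurable_funM => //; exact: measurableT_comp mf measurable_snd.
- by move=> q; exact: mule_ge0.
Qed.

(** Tonelli's theorem for [lam (tgt z)]; in the inner integral this measure is
    [lam (tgt w)], since almost every [w] lies in the fiber of [z]. *)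
Lemma integral_conv D E z f : measurable_fun setT D -> (forall p, 0 <= D p) ->
  measurable_fun setT E -> (forall p, 0 <= E p) ->
  measurable_fun setT f -> (forall e, 0 <= f e) ->
  \int[lam (tgt S z)]_e (f e * conv D E (z, e)) =
  \int[lam (tgt S z)]_w ((\int[lam (tgt S w)]_e (f e * E (w, e))) * D (z, w)).
Proof.
move=> mD D0 mE E0 mf f0; have [lamS _ _] := lam_borel.
have mDz := measurable_slice z mD.
have mEe e : measurable_fun setT (fun w => E (w, e)).
  exact: measurableT_comp mE (measurable_pair2 e).
have mEw w : measurable_fun setT (fun e => E (w, e)) by exact: measurable_slice.
have mF : measurable_fun setT (fun q : G * G => f q.1 * (D (z, q.2) * E (q.2, q.1))).
  apply: emeasurable_funM; first exact: measurableT_comp mf measurable_fst.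
  apply: emeasurable_funM; first exact: measurableT_comp mDz measurable_snd.
  by apply: measurableT_comp mE _; exact: measurable_fun_pair.
transitivity (\int[lam (tgt S z)]_e \int[lam (tgt S z)]_w
    (f e * (D (z, w) * E (w, e)))).
  apply: eq_integral => e _; rewrite /conv/= ge0_integralZl//.
  - exact: emeasurable_funM.
  - by move=> w _; exact: mule_ge0.
have F0 (q : G * G) : 0 <= f q.1 * (D (z, q.2) * E (q.2, q.1)).
  by rewrite mule_ge0// mule_ge0.
rewrite (sigma_finite_tonelli (lamS (tgt S z)) F0 mF)/=.
transitivity (\int[lam (tgt S z)]_w
    ((\int[lam (tgt S z)]_e (f e * E (w, e))) * D (z, w))).
  apply: eq_integral => w _; rewrite muleC -ge0_integralZl//.
  - by apply: eq_integral => e _; rewrite muleCA.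
  - exact: emeasurable_funM.
  - by move=> e _; exact: mule_ge0.
apply: (eq_integral_fiber lam_borel).
- apply: emeasurable_funM mDz.
  apply: (measurable_integral_fiber lam_borel lam_proper
    (tau := fun=> tgt S z) (f := fun q => f q.2 * E q)) => //.
    by apply: emeasurable_funM => //; exact: measurableT_comp mf measurable_snd.
  by move=> q; exact: mule_ge0.
- by apply: emeasurable_funM mDz; exact: measurable_kernel_integral.
- by move=> w; apply: mule_ge0 => //; apply: integral_ge0 => e _; exact: mule_ge0.
- by move=> w; apply: mule_ge0 => //; apply: integral_ge0 => e _; exact: mule_ge0.
- by move=> w ->.
Qed.

(** For equivariance, the translation by [z] is moved first through the step of
    [E], by [equivariant_gcomp], and then through the step of [D]. *)
Lemma markov_density_conv D E :
  markov_density S lam D -> markov_density S lam E ->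
  markov_density S lam (conv D E).
Proof.
move=> DM EM; have [mD D0 D1 Deq] := DM; have [mE E0 E1 Eeq] := EM.
split.
- exact: measurable_conv.
- by move=> p; apply: integral_ge0 => w _; exact: mule_ge0.
- move=> z; have := @integral_conv D E z (fun=> 1) mD D0 mE E0.
  move=> /(_ (@measurable_cst _ _ _ _ _ _) (fun=> lee01)).
  under eq_integral do rewrite mul1e.
  move=> ->; rewrite -[RHS](D1 z); apply: eq_integral => w _.
  under eq_integral do rewrite mul1e.
  by rewrite E1 mul1e.
move=> z f mf f0; set x := src S z; set u := unit_of S x.
have mfl : measurable_fun setT (fun e => f (lmul S z e)).
  exact: measurableT_comp mf (measurable_lmul S z).
pose h w := \int[lam (tgt S w)]_e (f e * E (w, e)).
have mh : measurable_fun setT h by exact: measurable_kernel_integral.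
have h0 w : 0 <= h w by apply: integral_ge0 => e _; exact: mule_ge0.
have mDu := measurable_slice u mD.
have tu : tgt S u = x by rewrite tgt_unit.
rewrite -[in LHS]tu integral_conv// tu.
transitivity (\int[lam x]_w (h (lmul S z w) * D (u, w))).
  apply: (eq_integral_fiber lam_borel).
  - by apply: emeasurable_funM mDu; exact: measurable_kernel_integral.
  - by apply: emeasurable_funM mDu; exact: measurableT_comp mh (measurable_lmul S z).
  - by move=> w; apply: mule_ge0 => //; apply: integral_ge0 => e _; exact: mule_ge0.
  - by move=> w; exact: mule_ge0.
  - move=> w tw; congr (_ * _); rewrite (equivariant_gcomp EM)//.
    by rewrite /h lmulE// tgt_gcomp.
by rewrite Deq// integral_conv.
Qed.

End convolution.

(** * Cesaro averages of the powers of a kernel *)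

Section average.
Local Open Scope ereal_scope.
Context (R : realType).

Definition average (T : Type) (F : nat -> T -> \bar R) (n : nat) (p : T) : \bar R :=
  (n.+1%:R^-1)%:E * \sum_(k < n.+1) F k p.

Lemma average_ge0 (T : Type) (F : nat -> T -> \bar R) n p :
  (forall k, 0 <= F k p) -> 0 <= average F n p.
Proof.
by move=> F0; rewrite mule_ge0 ?lee_fin ?invr_ge0//; apply: sume_ge0 => k _.
Qed.

Lemma measurable_average dT (T : measurableType dT) (F : nat -> T -> \bar R) n :
  (forall k, measurable_fun setT (F k)) -> measurable_fun setT (average F n).
Proof.
move=> mF; apply: emeasurable_funM => //.
by apply: emeasurable_sum => k; exact: mF.
Qed.

Lemma integral_average dT (T : measurableType dT) (m : {measure set T -> \bar R})
    (f : T -> \bar R) (F : nat -> T -> \bar R) n :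
  measurable_fun setT f -> (forall e, 0 <= f e) ->
  (forall k, measurable_fun setT (F k)) -> (forall k e, 0 <= F k e) ->
  \int[m]_e (f e * average F n e) = average (fun k _ => \int[m]_e (f e * F k e)) n tt.
Proof.
move=> mf f0 mF F0.
transitivity (\int[m]_e ((n.+1%:R^-1)%:E * \sum_(k < n.+1) (f e * F k e))).
  apply: eq_integral => e _; rewrite /average muleCA ge0_sume_distrr//.
rewrite ge0_integralZl//.
- rewrite ge0_integral_sum// => [k|k e _]; last exact: mule_ge0.
  exact: emeasurable_funM.
- by apply: emeasurable_sum => k; exact: emeasurable_funM.
- by move=> e _; apply: sume_ge0 => k _; exact: mule_ge0.
Qed.

End average.

Section cesaro.
Local Open Scope ereal_scope.
Context (R : realType) (d d0 : measure_display) (G : measurableType d)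
  (G0 : measurableType d0).
Variables (S : borel_semigroupoid R G G0) (lam : G0 -> {measure set G -> \bar R}).
Hypotheses (lam_borel : borel_system S lam) (lam_proper : proper_system lam).

Lemma markov_density_average F n : (forall k, markov_density S lam (F k)) ->
  markov_density S lam (average F n).
Proof.
move=> FM.
have mF k : measurable_fun setT (F k) by have [] := FM k.
have F0 k p : 0 <= F k p by have [_ /(_ p)] := FM k.
have mFz k z : measurable_fun setT (fun e => F k (z, e)).
  exact: measurable_slice.
have intE (m : {measure set G -> \bar R}) z f : measurable_fun setT f -> (forall e, 0 <= f e) ->
    \int[m]_e (f e * average F n (z, e)) =
    average (fun k _ => \int[m]_e (f e * F k (z, e))) n tt.
  move=> mf f0.
  exact: (@integral_average _ _ _ m f (fun k e => F k (z, e)) n mf f0 (mFz ^~ z)).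
split.
- exact: measurable_average.
- by move=> p; exact: average_ge0.
- move=> z; have := intE (lam (tgt S z)) z (fun=> 1) (measurable_cst _) (fun=> lee01).
  under eq_integral do rewrite mul1e.
  move=> ->; rewrite /average.
  under eq_bigr => k _.
    under eq_integral do rewrite mul1e.
    have [_ _ -> _] := FM k; over.
  rewrite sumEFin -EFinM; congr EFin.
  by rewrite sumr_const card_ord -mulr_natr mul1r mulVf.
- move=> z f mf f0; rewrite !intE//; last first.
    exact: measurableT_comp mf (measurable_lmul S z).
  rewrite /average; congr (_ * _); apply: eq_bigr => k _.
  by have [_ _ _ ->] := FM k.
Qed.

Fixpoint iter_density (D : G * G -> \bar R) (k : nat) : G * G -> \bar R :=
  if k is k'.+1 then conv S lam D (iter_density D k') else D.

Lemma markov_density_iter D k : markov_density S lam D ->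
  markov_density S lam (iter_density D k).
Proof.
by move=> DM; elim: k => //= k ih; exact: markov_density_conv.
Qed.

(** One more application of the kernel shifts the average by one step, which
    changes it by the difference of its first and last terms over [n.+1]. *)
Lemma average_approx_harmonic D (B : set G) n : measurable B ->
  markov_density S lam D ->
  exists2 u : G -> R, in_unit_interval u &
    (forall z, (u z)%:E = \int[lam (tgt S z)]_(e in B) average (iter_density D) n (z, e)) /\
    (forall (K : probability G R) z,
      (forall A, measurable A -> K A = \int[lam (tgt S z)]_(e in A) D (z, e)) ->
      (`|\int[K]_y u y - u z| <= n.+1%:R^-1)%R).
Proof.
move=> mB DM; have [mD D0 D1 Deq] := DM.
pose E k := iter_density D k.
have EM k : markov_density S lam (E k) by exact: markov_density_iter.
have mE k : measurable_fun setT (E k) by have [] := EM k.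
have E0 k p : 0 <= E k p by have [_ /(_ p)] := EM k.
have m1B : measurable_fun setT (fun e => (\1_B e)%:E : \bar R).
  exact/measurable_EFinP.
have B0 e : 0 <= (\1_B e)%:E :> \bar R by rewrite lee_fin.
have mass F z : markov_density S lam F ->
    0 <= \int[lam (tgt S z)]_e ((\1_B e)%:E * F (z, e)) <= 1.
  move=> [mF F0 F1 _]; have mFz : measurable_fun setT (fun e => F (z, e)).
    exact: measurable_slice.
  rewrite -integral_indicM integral_ge0//= -(F1 z).
  exact: ge0_subset_integral.
pose a k z := \int[lam (tgt S z)]_e ((\1_B e)%:E * E k (z, e)).
have a01 k z : 0 <= a k z <= 1 by exact: mass.
have afin k z : a k z \is a fin_num.
  have /andP[? ?] := a01 k z.
  by rewrite ge0_fin_numE// (le_lt_trans _ (ltry 1)).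
have ma k : measurable_fun setT (a k) by exact: measurable_kernel_integral.
pose u z := fine (average a n z).
have UE z : \int[lam (tgt S z)]_(e in B) average E n (z, e) = average a n z.
  rewrite integral_indicM.
  rewrite (@integral_average _ _ _ _ (fun e => (\1_B e)%:E) (fun k e => E k (z, e)))//.
  by move=> k; exact: measurable_slice.
have U01 z : 0 <= average a n z <= 1.
  rewrite -UE integral_indicM; apply: mass; exact: markov_density_average.
have uE z : (u z)%:E = average a n z.
  have /andP[? ?] := U01 z.
  by rewrite /u fineK// ge0_fin_numE// (le_lt_trans _ (ltry 1)).
have ur z : u z = (n.+1%:R^-1 * \sum_(k < n.+1) fine (a k z))%R.
  apply: EFin_inj; rewrite uE EFinM -sumEFin /average; congr (_ * _).
  by apply: eq_bigr => k _; rewrite fineK.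
exists u.
  split => [|z]; first by apply: measurableT_comp => //; exact: measurable_average.
  by rewrite -!lee_fin uE.
split => [z|K z KE]; first by rewrite uE -UE.
have mDz : measurable_fun setT (fun e => D (z, e)).
  exact: measurable_slice.
have -> : (\int[K]_y u y = n.+1%:R^-1 * \sum_(k < n.+1) fine (a k.+1 z))%R.
  rewrite /Rintegral; under eq_integral do rewrite uE.
  rewrite (@ge0_integral_density _ _ _ (lam (tgt S z)) K (fun e => D (z, e)))//; last 2 first.
  - exact: measurable_average.
  - by move=> w; have /andP[] := U01 w.
  under eq_integral do rewrite muleC.
  rewrite (@integral_average _ _ _ _ (fun e => D (z, e)) a)//; last first.
    by move=> k w; have /andP[] := a01 k w.
  rewrite /average (eq_bigr (fun k : 'I_n.+1 => (fine (a k.+1 z))%:E)).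
    by rewrite sumEFin -EFinM.
  move=> k _; rewrite fineK// [RHS]/a /E/= integral_conv//.
  by apply: eq_integral => w _; rewrite muleC.
rewrite ur -mulrBr -sumrB normrM ger0_norm ?invr_ge0//.
rewrite -[leRHS]mulr1 ler_wpM2l ?invr_ge0//.
rewrite -(big_mkord xpredT (fun k => fine (a k.+1 z) - fine (a k z))%R).
rewrite telescope_sumr//.
have := a01 n.+1 z; have := a01 0%N z.
rewrite -(fineK (afin 0%N z)) -(fineK (afin n.+1 z)) !lee_fin.
by move=> /andP[? ?] /andP[? ?]; rewrite ler_norml; apply/andP; split; lra.
Qed.

End cesaro.

(** * The defect of an adapted system *)

Section defect.
Local Open Scope ereal_scope.
Context (R : realType) (d d0 : measure_display) (G : measurableType d)
  (G0 : measurableType d0) (M : measure_semigroupoid R G G0).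

Notation S := (ms_semigroupoid M).
Notation lam := (ms_lambda M).

Let lam_borel : borel_system S lam.
Proof. by have [] := ms_quasi_haar M. Qed.

Let lam_proper : proper_system lam. Proof. exact: ms_proper. Qed.

Variables (theta : G0 -> probability G R) (D : G * G -> \bar R).
Hypotheses (DM : markov_density S lam D)
  (thetaE : forall x A, measurable A ->
    theta x A = \int[lam x]_(e in A) D (unit_of S x, e)).

Let mD z : measurable_fun setT (fun e => D (z, e)).
Proof. by have [? _ _ _] := DM; exact: measurable_slice. Qed.

Let D0 p : 0 <= D p. Proof. by have [_ ? _ _] := DM. Qed.

Let intD z : (lam (tgt S z)).-integrable setT (fun e => D (z, e)).
Proof.
apply/integrableP; split => //.
under eq_integral do rewrite gee0_abs//.
by have [_ _ -> _] := DM; exact: ltry.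
Qed.

Let r g e := D (unit_of S (tgt S g), e) - D (g, e).

Let intDu g : (lam (tgt S g)).-integrable setT
  (fun e => D (unit_of S (tgt S g), e)).
Proof. by have := intD (unit_of S (tgt S g)); rewrite tgt_unit. Qed.

Let intr g : (lam (tgt S g)).-integrable setT (r g).
Proof. exact: integrableB. Qed.

Let intrA g A : measurable A ->
  \int[lam (tgt S g)]_(e in A) r g e =
  \int[lam (tgt S g)]_(e in A) D (unit_of S (tgt S g), e) -
  \int[lam (tgt S g)]_(e in A) D (g, e).
Proof.
move=> mA; have sA : A `<=` setT by [].
have i1 := integrableS measurableT mA sA (intDu g).
have i2 := integrableS measurableT mA sA (intD g).
by rewrite -integralB.
Qed.

Let intr0 g : \int[lam (tgt S g)]_e r g e = 0.
Proof.
rewrite intrA//; have [_ _ D1 _] := DM; rewrite D1.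
by have := D1 (unit_of S (tgt S g)); rewrite tgt_unit => ->; rewrite subee.
Qed.

Lemma defectE g : (defect M theta g)%:E = \int[lam (tgt S g)]_e `|r g e|.
Proof.
rewrite /defect (@total_variation_integral _ _ _ (lam (tgt S g)) (r g))//.
  by rewrite fineK//; apply: integrable_fin_num => //; exact: integrable_abse.
move=> A mA; rewrite intrA// thetaE//.
by rewrite (markov_density_translate lam_borel DM thetaE).
Qed.

(** The total mass of [r g] is [0], so the mass of its absolute value is twice
    that of its positive part. *)
Lemma defect_gap g : exists2 B, measurable B & forall u : G -> R,
  (forall z, (u z)%:E = \int[lam (tgt S z)]_(e in B) D (z, e)) ->
  defect M theta g = (2 * (u (unit_of S (tgt S g)) - u g))%R.
Proof.
have mr : measurable_fun setT (r g) by exact: measurable_int (intr g).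
have mB : measurable [set e | 0 <= r g e].
  by rewrite -[X in measurable X]setTI; exact: emeasurable_fun_c_infty.
exists [set e | 0 <= r g e] => // u uE; apply: EFin_inj.
rewrite defectE integral_abs_mean0// intrA//.
have := uE (unit_of S (tgt S g)); rewrite tgt_unit => <-.
by rewrite -uE -EFinB -EFinM.
Qed.

Lemma defect_ge0 g : (0 <= defect M theta g)%R.
Proof. by rewrite -lee_fin defectE; exact: integral_ge0. Qed.

Lemma defect_le2 g : (defect M theta g <= 2)%R.
Proof.
rewrite -lee_fin defectE.
apply: (@le_trans _ _ (\int[lam (tgt S g)]_e
    (D (unit_of S (tgt S g), e) + D (g, e)))).
  apply: ge0_le_integral => //.
  - by apply: measurableT_comp => //; exact: measurable_int (intr g).
  - exact: emeasurable_funD.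
  - move=> e _; rewrite /r; apply: le_trans (lee_abs_sub _ _) _.
    by rewrite !gee0_abs.
rewrite ge0_integralD//; have [_ _ D1 _] := DM; rewrite D1.
have := D1 (unit_of S (tgt S g)); rewrite tgt_unit => ->.
by rewrite -EFinD.
Qed.

Lemma measurable_defect : measurable_fun setT (defect M theta).
Proof.
apply/measurable_EFinP.
rewrite (_ : _ \o _ = fun g => \int[lam (tgt S g)]_e `|r g e|); last first.
  by apply/funext => g /=; rewrite defectE.
have [mDD _ _ _] := DM.
apply: (measurable_integral_fiber lam_borel lam_proper (tau := tgt S)
  (f := fun q => `|D (unit_of S (tgt S q.1), q.2) - D q|)) => //.
  exact: bs_measurable_tgt.
apply: measurableT_comp => //; apply: emeasurable_funB => //.
apply: measurableT_comp mDD _; apply: measurable_fun_pair => //.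
apply: measurableT_comp (measurable_unit_of S) _.
exact: measurableT_comp (bs_measurable_tgt S) measurable_fst.
Qed.

End defect.

(** * Convergence of the defects under the Liouville property *)

Section liouville_limit.
Context (R : realType) (d d0 : measure_display) (G : measurableType d)
  (G0 : measurableType d0) (M : measure_semigroupoid R G G0).

Notation S := (ms_semigroupoid M).
Notation lam := (ms_lambda M).

Let lam_borel : borel_system S lam.
Proof. by have [] := ms_quasi_haar M. Qed.

Let lam_proper : proper_system lam. Proof. exact: ms_proper. Qed.

Variables (law : G0 -> probability G R) (D : G * G -> \bar R).
Hypotheses (DM : markov_density S lam D)
  (lawE : forall x A, measurable A ->
    law x A = (\int[lam x]_(e in A) D (unit_of S x, e))%E).

(** These are the translates of [law (src z)] by [z]. *)
Let kernelP z : exists K : probability G R, forall A, measurable A ->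
  K A = (\int[lam (tgt S z)]_(e in A) D (z, e))%E.
Proof.
have [mD D0 D1 _] := DM; apply: density_probability => //.
exact: measurable_slice.
Qed.

(** Both sides integrate [H] against the translate of [law (src z)] by [z]. *)
Lemma markov_op_kernel (K : probability G R) z (H : G -> R) :
  (forall A, measurable A -> K A = (\int[lam (tgt S z)]_(e in A) D (z, e))%E) ->
  in_unit_interval H ->
  markov_op M law (fun e => (H e)%:C%C) z = ((\int[K]_y H y)%:C)%C.
Proof.
move=> KE [mH H01]; have [mD D0 _ Deq] := DM.
have mDz w : measurable_fun setT (fun e => D (w, e)).
  exact: measurable_slice.
have H0 e : (0 <= (H e)%:E)%E by have /andP[] := H01 e; rewrite lee_fin.
have mHE : measurable_fun setT (fun e => (H e)%:E) by exact/measurable_EFinP.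
have mHl : measurable_fun setT (fun e => (H (lmul S z e))%:E).
  exact: measurableT_comp mHE (measurable_lmul S z).
have lawF : law (src S z) (~` fiber S (src S z)) = 0%E.
  have [_ lamF _] := lam_borel.
  have mFC := measurableC (measurable_fiber S (src S z)).
  apply: (eq_trans (lawE _ mFC)); apply: null_set_integral => //.
  exact: measurable_funTS.
rewrite /markov_op /cintegral /=.
rewrite [X in Complex _ (fine X)](_ : _ = 0%E); last first.
  by rewrite integral0_eq.
rewrite /real_complex_def; congr (Complex (fine _) _).
transitivity (\int[law (src S z)]_(e in fiber S (src S z)) (H (lmul S z e))%:E)%E.
  by apply: eq_integral => e /[!inE] Fe; rewrite lmulE.
transitivity (\int[law (src S z)]_e (H (lmul S z e))%:E)%E.
  rewrite [RHS](@ge0_negligible_integral _ _ _ _ setT (~` fiber S (src S z)))//.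
  - by rewrite setTD setCK.
  - exact/measurableC/measurable_fiber.
have H0l e : (0 <= (H (lmul S z e))%:E)%E by exact: H0.
have D0u e : (0 <= D (unit_of S (src S z), e))%E by exact: D0.
have D0z e : (0 <= D (z, e))%E by exact: D0.
rewrite (ge0_integral_density (mDz _) D0u (lawE (src S z)) mHl H0l).
rewrite (Deq z (fun e => (H e)%:E))//.
by rewrite (ge0_integral_density (mDz z) D0z KE mHE H0).
Qed.

(** If the defect stayed above [eps] along a subsequence, a harmonic function
    would separate [g] from the unit over [tgt g]. *)
Lemma liouville_defect_cvg (theta : nat -> G0 -> probability G R) (g : G) :
  (forall n x A, measurable A -> theta n x A =
    (\int[lam x]_(e in A) average (iter_density S lam D) n (unit_of S x, e))%E) ->
  harmonic_functions M law (tgt S g) = ae_constant M (tgt S g) ->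
  (fun n => defect M (theta n) g) @ \oo --> (0 : R).
Proof.
move=> thetaE harmE; set x := tgt S g in harmE *.
have [mD D0 D1 Deq] := DM.
have mDz w : measurable_fun setT (fun e => D (w, e)).
  exact: measurable_slice.
have AM n : markov_density S lam (average (iter_density S lam D) n).
  by apply: markov_density_average => k; exact: markov_density_iter.
have [K KE] := choice kernelP.
have Klam z : fiber S x z -> K z `<< lam x.
  move=> <-; apply/null_content_dominatesP => A mA A0.
  apply: (eq_trans (KE z A mA)); apply: null_set_integral => //.
  exact: measurable_funTS.
have [lamS lamF _] := lam_borel.
have [m lamm] := dominating_finite_measure (lamS x).
apply/cvgr0Pnorm_lt => eps eps0; apply: contrapT => far.
have often N : exists2 n, (N <= n)%N & eps <= defect M (theta n) g.
  apply: contrapT => h; apply: far; exists N => // n /= Nn.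
  rewrite ger0_norm; last exact: (defect_ge0 (AM n) (thetaE n)).
  by rewrite ltNge; apply/negP => le; apply: h; exists n.
have approx N : exists u : G -> R, [/\ in_unit_interval u,
    forall z, fiber S x z -> `|\int[K z]_y u y - u z| <= N.+1%:R^-1
    & eps / 2 <= u (unit_of S x) - u g].
  have [n Nn gap] := often N.
  have [B mB defB] := defect_gap (AM n) (thetaE n) g.
  have [u u01 [uE uK]] := average_approx_harmonic lam_borel lam_proper n mB DM.
  exists u; split => // [z _|].
    apply: le_trans (uK (K z) z (KE z)) _.
    by rewrite lef_pV2 ?posrE// ler_nat ltnS.
  by move: gap; rewrite (defB u uE) -/x; lra.
have Fu : fiber S x (unit_of S x) by rewrite /fiber/= tgt_unit.
have [H [H01 Hh Hgap]] := harmonic_limit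
  (fun z Fz => null_dominates_trans (Klam z Fz) lamm) Fu (erefl : fiber S x g) approx.
have [mH Hb] := H01.
have : harmonic_functions M law x (fun e => (H e)%:C%C).
  split.
    split; first by split => //; exact: measurable_cst.
    apply: (@le_lt_trans _ _ 1%E); last exact: ltry.
    apply/ess_supP/aeW => e; rewrite lee_fin /=.
    have /andP[? ?] := Hb e.
    by rewrite expr0n/= addr0 sqrtr_sqr ger0_norm.
  exists (~` fiber S x); split => //.
    exact/measurableC/measurable_fiber.
  move=> z /=; apply: contra_not => Fz.
  by rewrite (markov_op_kernel (KE z) H01) Hh.
rewrite harmE => -[_ [c Hc]].
have Hconst z : fiber S x z -> H z = complex.Re c.
  move=> Fz; rewrite -(Hh z Fz).
  have aeK : {ae K z, forall e, setT e -> (H e)%:E = (complex.Re c)%:E}.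
    have /null_content_dominatesP Kz := Klam z Fz.
    have : {ae K z, forall e, (H e)%:C%C = c}.
      by case: Hc => N [mN N0 sN]; exists N; split => //; exact: Kz.
    by apply: filterS => e <- _.
  rewrite /Rintegral (ae_eq_integral (fun=> (complex.Re c)%:E))//.
    rewrite integral_cst//.
    rewrite [X in (_ * X)%E](_ : _ = 1%E) ?mule1//.
    exact: (@probability_setT _ _ _ (K z)).
  exact/measurable_EFinP.
move: Hgap; rewrite (Hconst _ Fu) (Hconst g erefl) subrr; move: eps0; lra.
Qed.

End liouville_limit.

(** * Dominated convergence *)

Section star_measure.
Local Open Scope ereal_scope.
Context (R : realType) (d d0 : measure_display) (G : measurableType d)
  (G0 : measurableType d0).
Variables (S : borel_semigroupoid R G G0) (lam : G0 -> {measure set G -> \bar R})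
  (mu : {measure set G0 -> \bar R}).
Hypothesis lam_borel : borel_system S lam.

(** The hypothesis is an argument so that the measure structure can be inferred. *)
Definition star_measure of borel_system S lam : set G -> \bar R := star mu lam.

Let mlam A : measurable A -> measurable_fun setT (fun x => lam x A).
Proof. exact: (borel_system_measurable lam_borel). Qed.

Let star0 : star_measure lam_borel set0 = 0.
Proof. by rewrite /star_measure /star integral0_eq. Qed.

Let star_ge0 A : 0 <= star_measure lam_borel A.
Proof. exact: integral_ge0. Qed.

Let star_sigma_additive : semi_sigma_additive (star_measure lam_borel).
Proof.
move=> F mF tF mUF; rewrite /star_measure /star.
rewrite [X in _ --> X](_ : _ = \sum_(n <oo) \int[mu]_x lam x (F n)); last first.
  rewrite -integral_nneseries//; last by move=> n; exact: mlam.
  by apply: eq_integral => x _; exact: measure_semi_bigcup.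
by apply: is_cvg_ereal_nneg_natsum_cond => // n _ _; exact: integral_ge0.
Qed.

HB.instance Definition _ := isMeasure.Build _ _ _ (star_measure lam_borel)
  star0 star_ge0 star_sigma_additive.

(** For [x] outside a null set [N], the preimage of [N] by the target map misses
    the fiber over [x]. *)
Lemma ae_star_fiber (P : G0 -> Prop) :
  {ae mu, forall x, P x} -> {ae star_measure lam_borel, forall g, P (tgt S g)}.
Proof.
have [_ lamF _] := lam_borel.
move=> [N [mN N0 sN]]; exists (tgt S @^-1` N); split.
- by rewrite -[X in measurable X]setTI; exact: bs_measurable_tgt.
- have mT : measurable (tgt S @^-1` N).
    by rewrite -[X in measurable X]setTI; exact: bs_measurable_tgt.
  rewrite /star_measure /star.
  rewrite (@ge0_negligible_integral _ _ _ _ setT N)//; last exact: mlam.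
  apply: integral0_eq => x [_ Nx]; apply/eqP.
  rewrite eq_le measure_ge0 andbT -(lamF x); apply: le_measure; rewrite ?inE//.
    exact/measurableC/measurable_fiber.
  by move=> g /= Ng xg; apply: Nx; rewrite -xg.
- by move=> g /= nP; apply: sN.
Qed.

End star_measure.

Lemma cvg_complex0 (R : realType) (u v : R^nat) :
  u @ \oo --> (0 : R) -> v @ \oo --> (0 : R) ->
  (fun n => Complex (u n) (v n)) @ \oo --> (0 : R[i]^o).
Proof.
move=> u0 v0; apply/(@cvgr0Pnorm_lt R[i] R[i]^o) => -[e i].
rewrite ltcE/= => /andP[/eqP i0 e0].
have e20 : 0 < e / 2 by rewrite divr_gt0.
have hu := cvgr0_norm_lt _ u0 _ e20; have hv := cvgr0_norm_lt _ v0 _ e20.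
near=> n.
have un : `|u n| < e / 2 by near: n; exact: hu.
have vn : `|v n| < e / 2 by near: n; exact: hv.
rewrite ltcE/= i0 eqxx/=.
have := sqr_ge0 (`|u n| - `|v n|).
rewrite -(@ltr_pXn2r _ 2)// ?nnegrE ?sqrtr_ge0//; last exact: ltW.
rewrite sqr_sqrtr ?addr_ge0 ?sqr_ge0//.
rewrite -[u n ^+ 2]real_normK ?num_real// -[v n ^+ 2]real_normK ?num_real//.
move: (normr_ge0 (u n)) (normr_ge0 (v n)) => a0 b0 _.
by nra.
Unshelve. all: by end_near. Qed.

Lemma Re_real_complexM (R : realType) (a : R) (z : R[i]) :
  complex.Re (real_complex R a * z) = a * complex.Re z.
Proof. by case: z => p q /=; rewrite mul0r subr0. Qed.

Lemma Im_real_complexM (R : realType) (a : R) (z : R[i]) :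
  complex.Im (real_complex R a * z) = a * complex.Im z.
Proof. by case: z => p q /=; rewrite mul0r addr0. Qed.

Theorem theorem4p1 (R : realType) (d d0 : measure_display)
    (G : measurableType d) (G0 : measurableType d0)
    (M : measure_semigroupoid R G G0) :
  liouville M -> reiter M.
Proof.
move=> [law [lawA harm]].
have [lam_borel _ _] := ms_quasi_haar M.
have lam_proper := ms_proper M.
have [D DM lawE] := adapted_markov_density lawA.
pose A n := average (iter_density M (ms_lambda M) D) n.
have AM n : markov_density M (ms_lambda M) (A n).
  by apply: markov_density_average => k; exact: markov_density_iter.
have thetaP (p : nat * G0) : exists P : probability G R, forall B, measurable B ->
    P B = (\int[ms_lambda M p.2]_(e in B) A p.1 (unit_of M p.2, e))%E.
  have [mA A0 A1 _] := AM p.1; apply: density_probability => //.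
    exact: measurable_slice.
  by have := A1 (unit_of M p.2); rewrite tgt_unit.
have [theta' theta'E] := choice thetaP.
pose theta n x := theta' (n, x).
have thetaE n x B : measurable B ->
    theta n x B = (\int[ms_lambda M x]_(e in B) A n (unit_of M x, e))%E.
  by move=> mB; exact: (theta'E (n, x)).
exists theta; split.
  by move=> n; exact: (markov_density_adapted lam_borel lam_proper (AM n) (thetaE n)).
pose sm : {measure set G -> \bar R} := star_measure (ms_mu M) lam_borel.
have smE : (sm : set G -> \bar R) = star (ms_mu M) (ms_lambda M) by [].
have dcvg : {ae sm, forall g, (fun n => defect M (theta n) g) @ \oo --> (0 : R)}.
  have := ae_star_fiber lam_borel harm.
  by apply: filterS => g; exact: (liouville_defect_cvg DM lawE thetaE).
have lim0 h : sm.-integrable setT (EFin \o h) ->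
    (fun n => fine (\int[sm]_g (defect M (theta n) g * h g)%:E)%E) @ \oo --> (0 : R).
  move=> ih; have /measurable_EFinP mh := measurable_int _ ih.
  have mdef n : measurable_fun setT (defect M (theta n)).
    exact: (measurable_defect (AM n) (thetaE n)).
  have mf n : measurable_fun setT (fun g => (defect M (theta n) g * h g)%:E).
    by apply/measurable_EFinP; exact: measurable_funM (mdef n) mh.
  have cf : {ae sm, forall g, setT g ->
      (fun n => (defect M (theta n) g * h g)%:E) @ \oo --> 0%E}.
    apply: filterS dcvg => g dg _; apply: cvg_EFin; first exact: nearW.
    by rewrite -(mul0r (h g)); apply: cvgMr_tmp.
  have ih2 : sm.-integrable setT (fun g => 2%:E * `|h g|%:E)%E.
    exact: (integrableZl measurableT 2 (integrable_norm ih)).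
  have bf : {ae sm, forall g n, setT g ->
      (`|(defect M (theta n) g * h g)%:E| <= 2%:E * `|h g|%:E)%E}.
    apply: aeW => g n _; rewrite abse_EFin normrM -EFinM lee_fin ler_wpM2r//.
    rewrite ger0_norm; first exact: (defect_le2 (AM n) (thetaE n)).
    exact: (defect_ge0 (AM n) (thetaE n)).
  have [_ _] := dominated_convergence measurableT mf (measurable_cst 0%E) cf ih2 bf.
  by rewrite integral0 => h0; apply: fine_cvg.
move=> f [iRe iIm].
rewrite -smE in iRe iIm *.
have ReE n : (fun g => (complex.Re (real_complex R (defect M (theta n) g) * f g))%:E) =
    (fun g => (defect M (theta n) g * complex.Re (f g))%:E).
  by apply/funext => g; rewrite Re_real_complexM.
have ImE n : (fun g => (complex.Im (real_complex R (defect M (theta n) g) * f g))%:E) =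
    (fun g => (defect M (theta n) g * complex.Im (f g))%:E).
  by apply/funext => g; rewrite Im_real_complexM.
rewrite /cintegral; under eq_fun do rewrite ReE ImE.
by apply: cvg_complex0; exact: lim0.
Qed.
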